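(* Let $1<p,q<\infty$ with $\frac1p+\frac1q=1$, and let $C_0$ be the discrete Cesàro operator on the complex Banach space $\ell^p$, $(C_0f)(n)=\frac1{n+1}\sum_{k=0}^nf(k)$, $n\ge 0$. The adjoint operator $C_0^*\in\mathcal B(\ell^q)$ has rich point spectrum.
   Context: $\mathcal B(E)$ is the algebra of bounded linear operators on $E$, and $\sigma_p(T)$ denotes the point spectrum (set of eigenvalues) of $T$. A bounded linear operator $T$ on a complex Banach space $E$ has rich point spectrum if $\sigma_p(T)$ has nonempty interior and for every (nonempty) open disc $D\subseteq\sigma_p(T)$ the family of eigenvectors $\bigcup_{z\in D}\ker(T-z)$ is a total set, i.e. its linear span is dense in $E$. The adjoint is given explicitly by $(C_0^*f)(n)=\sum_{k=n}^\infty\frac{f(k)}{k+1}$. *)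

(* Defs.v *)
From HB Require Import structures.
From mathcomp Require Import all_boot all_order all_algebra.
From mathcomp Require Import all_classical all_reals all_analysis.
From mathcomp Require Import complex ring lra.
Set Implicit Arguments. Unset Strict Implicit. Unset Printing Implicit Defensive.
Import Order.TTheory GRing.Theory Num.Theory.
Import numFieldNormedType.Exports.
Local Open Scope classical_set_scope.
Local Open Scope ring_scope.
Local Open Scope complex_scope.

Local Notation normc := ComplexField.Normc.normc.
Local Notation Re := complex.Re.
Local Notation Im := complex.Im.

(* The standard topology and norm of C = R[i]; `|z| is the R[i]-valued norm of
   ssrnum, while normc z : R is the real-valued modulus. *)
HB.instance Definition _ (R : rcfType) := NormedModule.copy R[i] (R[i])^o.

Section rich_point_spectrum.
Variables (R : realType).

(* Norms over R[i] are R[i]-valued; for E <> 0 the bound forces 0 <= M, hence M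
   is real. *)
Record bounded_operator (E F : normedModType R[i]) := BoundedOperator {
  bop_fun :> {linear E -> F};
  bop_bounded : exists M : R[i], forall x, `|bop_fun x| <= M * `|x| }.

Variable E : completeNormedModType R[i].
Implicit Types (A : set E) (T : bounded_operator E E) (z : R[i]).

Definition linear_span A : set E :=
  [set x | exists (n : nat) (c : 'I_n -> R[i]) (v : 'I_n -> E),
     (forall i, A (v i)) /\ x = \sum_(i < n) c i *: v i].

Definition total_set A := dense (linear_span A).

Definition kernel T z : set E := [set x | T x - z *: x = 0].

Definition point_spectrum T : set R[i] :=
  [set z | exists2 x, x != 0 & kernel T z x].

(* 0 < r in R[i] means that r is a positive real. *)
Definition rich_point_spectrum T :=
  (point_spectrum T)^° !=set0 /\
  forall c r : R[i], 0 < r -> ball c r `<=` point_spectrum T ->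
    total_set (\bigcup_(z in ball c r) kernel T z).

End rich_point_spectrum.

Section normc_facts.
Variable R : realType.
Implicit Types (x y : R[i]).

Lemma normcE x : `|x| = (normc x)%:C. Proof. by []. Qed.

Lemma normc_ge0 x : 0 <= normc x. Proof. by rewrite -ler0c -normcE. Qed.

Lemma ler_normcD x y : normc (x + y) <= normc x + normc y.
Proof. by rewrite -lecR rmorphD /= -!normcE ler_normD. Qed.

Lemma normcM x y : normc (x * y) = normc x * normc y.
Proof. exact: ComplexField.Normc.normcM. Qed.

Lemma normcN x : normc (- x) = normc x.
Proof. by apply: complexI; rewrite -!normcE normrN. Qed.

Lemma normc_eq0 x : normc x = 0 -> x = 0.
Proof. exact: ComplexField.Normc.eq0_normc. Qed.

Lemma normcR (a : R) : normc a%:C = `|a|.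
Proof. by rewrite /= expr0n /= addr0 sqrtr_sqr. Qed.

Lemma normc_conj x : normc x^* = normc x.
Proof. by case: x => a b /=; rewrite sqrrN. Qed.

Lemma Re_le_normc x : `|Re x| <= normc x.
Proof.
case: x => a b /=; rewrite -sqrtr_sqr ler_wsqrtr// lerDl; exact: sqr_ge0.
Qed.

Lemma Im_le_normc x : `|Im x| <= normc x.
Proof.
case: x => a b /=; rewrite -sqrtr_sqr ler_wsqrtr// lerDr; exact: sqr_ge0.
Qed.

Lemma normc_le_ReIm x : normc x <= `|Re x| + `|Im x|.
Proof.
rewrite [in leLHS](complexE x); apply: (le_trans (ler_normcD _ _)).
rewrite normcM !normcR /= expr0n expr1n /= add0r sqrtr1 mul1r. by [].
Qed.

Lemma conjM_normc x : x^* * x = (normc x ^+ 2)%:C.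
Proof.
case: x => a b /=; rewrite sqr_sqrtr ?addr_ge0 ?sqr_ge0//.
by simpc; congr (_ +i* _); ring.
Qed.

Lemma ReD : {morph (@Re R : R[i] -> R) : x y / x + y}.
Proof. by move=> [a b] [c d]. Qed.

Lemma ImD : {morph (@Im R : R[i] -> R) : x y / x + y}.
Proof. by move=> [a b] [c d]. Qed.

Lemma ReB : {morph (@Re R : R[i] -> R) : x y / x - y}.
Proof. by move=> [a b] [c d]. Qed.

Lemma ImB : {morph (@Im R : R[i] -> R) : x y / x - y}.
Proof. by move=> [a b] [c d]. Qed.

Lemma Re_sum (I : Type) (s : seq I) (f : I -> R[i]) :
  Re (\sum_(i <- s) f i) = \sum_(i <- s) Re (f i).
Proof. exact: (big_morph _ ReD). Qed.

Lemma Im_sum (I : Type) (s : seq I) (f : I -> R[i]) :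
  Im (\sum_(i <- s) f i) = \sum_(i <- s) Im (f i).
Proof. exact: (big_morph _ ImD). Qed.

Lemma ler_normc_sum (I : Type) (s : seq I) (f : I -> R[i]) :
  normc (\sum_(i <- s) f i) <= \sum_(i <- s) normc (f i).
Proof.
elim: s => [|i s IH]; first by rewrite !big_nil normcR normr0.
by rewrite !big_cons (le_trans (ler_normcD _ _))// lerD2l.
Qed.

Lemma cvg_complex (u : nat -> R[i]) (a b : R) :
  Re (u n) @[n --> \oo] --> a -> Im (u n) @[n --> \oo] --> b ->
  u @ \oo --> a +i* b.
Proof.
move=> /cvgrPdist_lt ua /cvgrPdist_lt ub; apply/cvgrPdist_lt => -[e e'].
rewrite ltcE /= => /andP[/eqP -> e0].
have e20 : 0 < e / 2 by rewrite divr_gt0.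
near=> n.
rewrite normcE ltcR (le_lt_trans (normc_le_ReIm _))// ReB ImB /=.
rewrite [ltRHS]splitr ltrD//; near: n; [exact: ua|exact: ub].
Unshelve. all: by end_near. Qed.

Lemma cvg_cseriesP (u : nat -> R[i]) (M : R) :
  (forall n, \sum_(0 <= k < n) normc (u k) <= M) ->
  cvgn (series u).
Proof.
move=> uM.
have H (v : nat -> R) : (forall n, `|v n| <= normc (u n)) -> cvgn (series v).
  move=> vu; apply: normed_cvg; apply: nondecreasing_is_cvgn.
    by apply: nondecreasing_series => n _ _; exact: normr_ge0.
  exists M => _ [n _ <-]; apply: le_trans (uM n); rewrite /series/=.
  by apply: ler_sum => i _; exact: vu.
have HR := H (fun n => Re (u n)) (fun n => Re_le_normc (u n)).
have HI := H (fun n => Im (u n)) (fun n => Im_le_normc (u n)).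
apply/cvg_ex; exists (limn (series (fun n => Re (u n))) +i* limn (series (fun n => Im (u n)))).
by apply: cvg_complex; [move: HR|move: HI]; rewrite /series /= => h;
  [under eq_fun do rewrite Re_sum|under eq_fun do rewrite Im_sum].
Qed.

Lemma normc_lim_le (u : nat -> R[i]) (M : R) : cvgn u ->
  (forall n, normc (u n) <= M) -> normc (limn u) <= M.
Proof.
move=> cu uM; apply/ler_addgt0Pr => e e0.
have /cvgrPdist_lt /(_ e%:C) : u @ \oo --> limn u by [].
rewrite ltcR => /(_ e0) [N _ /(_ N (leqnn _))]; rewrite /= normcE ltcR => h.
rewrite -(subrK (u N) (limn u)) (le_trans (ler_normcD _ _))// addrC.
by rewrite lerD// ltW.
Qed.

End normc_facts.

Section real_sums.
Variable R : realType.
Implicit Types (p q : R) (u v : nat -> R).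

Lemma ler_pow p (a b : R) : 0 <= p -> 0 <= a -> a <= b -> a `^ p <= b `^ p.
Proof.
by move=> p0 a0 ab; apply: ge0_ler_powR; rewrite ?nnegrE// (le_trans a0).
Qed.

Lemma powRK p (a : R) : 0 < p -> 0 <= a -> (a `^ p^-1) `^ p = a.
Proof. by move=> p0 a0; rewrite -powRrM mulVf ?gt_eqF// powRr1. Qed.

Lemma powRVK p (a : R) : 0 < p -> 0 <= a -> (a `^ p) `^ p^-1 = a.
Proof. by move=> p0 a0; rewrite -powRrM mulfV ?gt_eqF// powRr1. Qed.

Lemma powR_div p (x a : R) : 0 <= x -> 0 < a -> x `^ p / a `^ p = (x / a) `^ p.
Proof.
move=> x0 a0; rewrite powRM ?invr_ge0 ?(ltW a0)//; congr (_ * _).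
by rewrite -[in RHS]powR_inv1 ?(ltW a0)// powRAC powR_inv1// powR_ge0.
Qed.

Lemma sum_powR_eq0 p u n : 0 < p ->
  \sum_(0 <= k < n) u k `^ p <= 0 -> forall k, (k < n)%N -> u k = 0.
Proof.
move=> p0 s0 k kn; apply/(@powR_eq0_eq0 _ _ p)/eqP.
rewrite eq_le powR_ge0 andbT (le_trans _ s0)//.
rewrite big_mkord (bigD1 (Ordinal kn))//= lerDl sumr_ge0// => i _.
exact: powR_ge0.
Qed.

Lemma minkowski_sum p u v n (a b : R) : 1 <= p ->
  (forall k, 0 <= u k) -> (forall k, 0 <= v k) -> 0 <= a -> 0 <= b ->
  \sum_(0 <= k < n) u k `^ p <= a `^ p ->
  \sum_(0 <= k < n) v k `^ p <= b `^ p ->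
  \sum_(0 <= k < n) (u k + v k) `^ p <= (a + b) `^ p.
Proof.
move=> p1 u0 v0; have p0 : 0 < p by apply: lt_le_trans p1.
rewrite le_eqVlt => /predU1P[<-|a0].
  move=> _; rewrite powR0 ?gt_eqF// add0r => /(sum_powR_eq0 p0) z.
  by congr (_ <= _); apply: eq_big_nat => k /andP[_ kn]; rewrite z// add0r.
rewrite le_eqVlt => /predU1P[<-|b0].
  rewrite powR0 ?gt_eqF// addr0 => h /(sum_powR_eq0 p0) z; move: h.
  by congr (_ <= _); apply: eq_big_nat => k /andP[_ kn]; rewrite z// addr0.
move=> ua vb.
have ab0 : 0 < a + b by rewrite addr_gt0.
pose t := a / (a + b).
have t01 : 0 <= t <= 1.
  by rewrite /t divr_ge0 ?(ltW a0) ?(ltW ab0)//= ler_pdivrMr// mul1r lerDl ltW.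
have tE : 1 - t = b / (a + b) by rewrite /t; field; rewrite gt_eqF.
have key k : (u k + v k) `^ p <=
   (a + b) `^ p * (t * (u k `^ p / a `^ p) + (1 - t) * (v k `^ p / b `^ p)).
  have -> : u k + v k = (a + b) * (t * (u k / a) + (1 - t) * (v k / b)).
    by rewrite tE /t; field; rewrite !gt_eqF.
  case/andP: (t01) => t0 t1.
  have h0 : 0 <= t * (u k / a) + (1 - t) * (v k / b).
    by rewrite addr_ge0// mulr_ge0// ?subr_ge0// divr_ge0// ltW.
  rewrite powRM ?(ltW ab0)// ler_pM2l ?powR_gt0//.
  rewrite !powR_div//.
  have := convex_powR p1 (Itv01 t0 t1) (x := u k / a) (y := v k / b).
  by apply; rewrite inE /= in_itv /= andbT divr_ge0// ltW.
apply: (le_trans (ler_sum _ (fun k _ => key k))).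
rewrite -mulr_sumr ler_piMr ?powR_ge0// big_split /= -!mulr_sumr -!mulr_suml.
case/andP: t01 => t0 t1.
apply: (@le_trans _ _ (t * 1 + (1 - t) * 1)); last by rewrite !mulr1 addrC subrK.
by rewrite lerD// ler_wpM2l ?subr_ge0// ler_pdivrMr ?powR_gt0// mul1r.
Qed.

Lemma hoelder_sum p q u v n (a b : R) : 0 < p -> 0 < q -> p^-1 + q^-1 = 1 ->
  (forall k, 0 <= u k) -> (forall k, 0 <= v k) -> 0 <= a -> 0 <= b ->
  \sum_(0 <= k < n) u k `^ p <= a `^ p ->
  \sum_(0 <= k < n) v k `^ q <= b `^ q ->
  \sum_(0 <= k < n) u k * v k <= a * b.
Proof.
move=> p0 q0 pq u0 v0; rewrite le_eqVlt => /predU1P[<-|a0].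
  move=> _; rewrite powR0 ?gt_eqF// mul0r => /(sum_powR_eq0 p0) z _.
  by rewrite big_nat_cond big1// => k /andP[/andP[_ kn] _]; rewrite z// mul0r.
rewrite le_eqVlt => /predU1P[<-|b0].
  rewrite powR0 ?gt_eqF// mulr0 => _ /(sum_powR_eq0 q0) z.
  by rewrite big_nat_cond big1// => k /andP[/andP[_ kn] _]; rewrite z// mulr0.
move=> ua vb.
have key k : u k * v k <= a * b * (u k `^ p / a `^ p / p + v k `^ q / b `^ q / q).
  have -> : u k * v k = a * b * ((u k / a) * (v k / b)).
    by field; rewrite !gt_eqF.
  rewrite ler_pM2l ?mulr_gt0//.
  rewrite !powR_div//.
  by apply: conjugate_powR => //; rewrite divr_ge0// ltW.
apply: (le_trans (ler_sum _ (fun k _ => key k))).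
rewrite -mulr_sumr ler_piMr ?mulr_ge0 ?(ltW a0) ?(ltW b0)// big_split /= -!mulr_suml -pq.
by rewrite lerD// ler_piMl ?invr_ge0 ?(ltW p0) ?(ltW q0)// ler_pdivrMr ?powR_gt0// mul1r.
Qed.

(* Hardy's inequality, by Elliott's argument. *)
Lemma hardy_sum p q u n : 1 < p -> 1 < q -> p^-1 + q^-1 = 1 ->
  (forall k, 0 <= u k) ->
  \sum_(0 <= k < n) ((\sum_(0 <= j < k.+1) u j) / k.+1%:R) `^ p
    <= q `^ p * \sum_(0 <= k < n) u k `^ p.
Proof.
move=> p1 q1 pq u0.
have p0 : 0 < p by apply: lt_trans p1.
have q0 : 0 < q by apply: lt_trans q1.
pose s k := \sum_(0 <= j < k) u j.
pose al k := s k / k%:R.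
have al0 k : 0 <= al k by rewrite divr_ge0// sumr_ge0.
have pqE : p = q * (p - 1).
  have : q + p = p * q by rewrite -[RHS]mulr1 -pq; field; rewrite !gt_eqF.
  lra.
have alp k : al k `^ (p - 1) `^ q = al k `^ p by rewrite -powRrM mulrC -pqE.
have alm k : al k * al k `^ (p - 1) = al k `^ p by apply: mulr_powRB1.
have young k (b : R) : 0 <= b -> al k `^ (p - 1) * b <= al k `^ p / q + b `^ p / p.
  move=> b0; rewrite -alp; apply: conjugate_powR; rewrite ?powR_ge0//.
  by rewrite addrC.
have tele m : \sum_(0 <= k < m) al k.+1 `^ p + (q - 1) * m%:R * al m `^ p
     <= q * \sum_(0 <= k < m) al k.+1 `^ (p - 1) * u k.
  elim: m => [|m IH]; first by rewrite !big_geq// !mulr0 mul0r addr0.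
  rewrite !big_nat_recr//= mulrDr.
  have uE : u m = m.+1%:R * al m.+1 - m%:R * al m.
    rewrite /al mulrCA divff ?pnatr_eq0// mulr1.
    case: m {IH} => [|m]; first by rewrite /s big_nat1 mul0r subr0.
    rewrite mulrCA divff ?pnatr_eq0// mulr1.
    by rewrite /s [X in _ = X - _]big_nat_recr//= addrAC subrr add0r.
  rewrite [u m in leRHS]uE.
  have y := young m.+1 (al m) (al0 m).
  have y' : q * m%:R * (al m.+1 `^ (p - 1) * al m) <=
            q * m%:R * (al m.+1 `^ p / q + al m `^ p / p).
    by rewrite ler_wpM2l// mulr_ge0// ltW.
  have E1 : q * m%:R * (al m.+1 `^ p / q + al m `^ p / p) =
            m%:R * al m.+1 `^ p + (q - 1) * m%:R * al m `^ p.
    rewrite mulrDr; congr (_ + _); first by field; rewrite gt_eqF.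
    have -> : q - 1 = q / p.
      have : p^-1 = 1 - q^-1 by lra.
      by move=> ->; field; rewrite gt_eqF.
    by field; rewrite gt_eqF.
  have E2 : q * (al m.+1 `^ (p - 1) * (m.+1%:R * al m.+1 - m%:R * al m)) =
     q * m.+1%:R * al m.+1 `^ p - q * m%:R * (al m.+1 `^ (p - 1) * al m).
    by rewrite -alm; ring.
  rewrite E2; move: IH y'; rewrite E1 -natr1.
  set S := \sum_(_ <= _ < _) _; set S' := \sum_(_ <= _ < _) _ in E1 E2 *.
  lra.
have St : \sum_(0 <= k < n) al k.+1 `^ p <=
   q * \sum_(0 <= k < n) al k.+1 `^ (p - 1) * u k.
  apply: le_trans (tele n); rewrite lerDl !mulr_ge0 ?powR_ge0//.
  by rewrite subr_ge0 ltW.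
have : q * \sum_(0 <= k < n) al k.+1 `^ (p - 1) * u k <=
   (\sum_(0 <= k < n) al k.+1 `^ p) / q + (q `^ p * \sum_(0 <= k < n) u k `^ p) / p.
  rewrite !mulr_sumr !mulr_suml -big_split /=; apply: ler_sum => k _.
  rewrite mulrCA -powRM ?(ltW q0)//; apply: young.
  by rewrite mulr_ge0// ltW.
move=> /(le_trans St); rewrite -/(s _) -/(al _).
set S := \sum_(_ <= _ < _) al _.+1 `^ p; set Q := _ * _.
rewrite -lerBlDl (_ : S - S / q = S / p); last first.
  have -> : p^-1 = 1 - q^-1 by lra.
  by ring.
by rewrite ler_pM2r// invr_gt0.
Qed.

End real_sums.

Section lp_space.
Variable R : realType.
Implicit Types (p q M : R) (f g : nat -> R[i]).

Definition lp_summable p f := cvgn (series (fun n => normc (f n) `^ p)).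

(* Only meaningful for summable f: limn is total. *)
Definition lp_norm p f : R :=
  limn (series (fun n => normc (f n) `^ p)) `^ p^-1.

Lemma lp_norm_ge0 p f : 0 <= lp_norm p f. Proof. exact: powR_ge0. Qed.

Let nd p f : nondecreasing_seq (series (fun n => normc (f n) `^ p)).
Proof. by apply: nondecreasing_series => n _ _; exact: powR_ge0. Qed.

Lemma lp_sum_le p f n : 0 < p -> lp_summable p f ->
  \sum_(0 <= k < n) normc (f k) `^ p <= lp_norm p f `^ p.
Proof.
move=> p0 cf; have le_lim k := nondecreasing_cvgn_le (@nd p f) cf k.
rewrite powRK//; first exact: le_lim.
by apply: le_trans (le_lim 0%N); rewrite /series/= big_geq.
Qed.

Lemma lp_bound p f M : 0 < p -> 0 <= M ->
  (forall n, \sum_(0 <= k < n) normc (f k) `^ p <= M `^ p) ->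
  lp_summable p f /\ lp_norm p f <= M.
Proof.
move=> p0 M0 fM.
have cf : lp_summable p f.
  apply: nondecreasing_is_cvgn => //; exists (M `^ p) => _ [n _ <-]; exact: fM.
split=> //; rewrite -[leRHS](powRVK p0 M0); apply: ler_pow.
- by rewrite invr_ge0 ltW.
- by apply: le_trans (nondecreasing_cvgn_le (@nd p f) cf 0%N); rewrite /series/= big_geq.
- by apply: limr_le => //; apply: nearW => n; exact: fM.
Qed.

Lemma lpD p f g : 1 <= p -> lp_summable p f -> lp_summable p g ->
  lp_summable p (f + g) /\ lp_norm p (f + g) <= lp_norm p f + lp_norm p g.
Proof.
move=> p1 sf sg; have p0 : 0 < p by apply: lt_le_trans p1.
apply: lp_bound => //; first by rewrite addr_ge0// lp_norm_ge0.
move=> n; have /= := @minkowski_sum _ p _ _ n _ _ p1 (fun k => normc_ge0 (f k))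
  (fun k => normc_ge0 (g k)) (lp_norm_ge0 p f) (lp_norm_ge0 p g)
  (lp_sum_le n p0 sf) (lp_sum_le n p0 sg).
apply: le_trans; apply: ler_sum => k _; apply: ler_pow; rewrite ?normc_ge0 ?(ltW p0)//.
exact: ler_normcD.
Qed.

Lemma lpZ p f (z : R[i]) : 0 < p -> lp_summable p f ->
  lp_summable p (z *: f) /\ lp_norm p (z *: f) <= normc z * lp_norm p f.
Proof.
move=> p0 sf; apply: lp_bound => //.
  by rewrite mulr_ge0// ?normc_ge0// lp_norm_ge0.
move=> n; rewrite powRM ?normc_ge0 ?lp_norm_ge0//.
under eq_bigr do rewrite [normc _]normcM powRM ?normc_ge0//.
by rewrite -mulr_sumr ler_wpM2l ?powR_ge0// lp_sum_le.
Qed.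

Lemma lp0 p : 0 < p -> lp_summable p 0 /\ lp_norm p 0 <= 0.
Proof.
move=> p0; apply: lp_bound => // n.
rewrite big1 ?powR_ge0// => k _.
by rewrite [normc _]normcR normr0 powR0// gt_eqF.
Qed.

Lemma lp_norm_eq0 p f : 0 < p -> lp_summable p f -> lp_norm p f = 0 -> f = 0.
Proof.
move=> p0 sf f0; apply/funext => k; apply: normc_eq0.
apply: (@sum_powR_eq0 _ p (fun k => normc (f k)) k.+1) => //.
by apply: le_trans (lp_sum_le _ p0 sf) _; rewrite f0 powR0// gt_eqF.
Qed.

Lemma lp_coord p f k : 0 < p -> lp_summable p f -> normc (f k) <= lp_norm p f.
Proof.
move=> p0 sf; rewrite -[leLHS](powRVK p0 (normc_ge0 _)) -[leRHS](powRVK p0 (lp_norm_ge0 _ _)).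
apply: ler_pow; rewrite ?powR_ge0 ?invr_ge0 ?(ltW p0)//.
apply: le_trans (lp_sum_le k.+1 p0 sf); rewrite big_nat_recr//= lerDr sumr_ge0// => i _.
exact: powR_ge0.
Qed.

Definition lp_pred p : {pred nat -> R[i]} := [pred f | `[< lp_summable p f >]].

(* The proof of 1 <= p is a parameter so that lp p1 is canonically a Banach
   space. *)
Record lp p (p1 : 1 <= p) := Lp { lp_val :> nat -> R[i]; _ : lp_val \in lp_pred p }.

End lp_space.

Section lp_instances.
Variables (R : realType) (p : R) (p1 : 1 <= p).

Lemma exponent_gt0 : 0 < p. Proof. exact: lt_le_trans p1. Qed.
Let p0 := exponent_gt0.

HB.instance Definition _ := [isSub for @lp_val R p p1].
HB.instance Definition _ := [Choice of lp p1 by <:].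

Lemma lp_submod_closed : submod_closed (lp_pred p).
Proof.
split; first by apply/asboolP; apply: (lp0 p0).1.
move=> z f g /asboolP sf /asboolP sg; apply/asboolP.
by apply: (lpD p1 _ sg).1; apply: (lpZ z p0 sf).1.
Qed.

#[local] HB.instance Definition _ := GRing.isSubmodClosed.Build _ _ (lp_pred p) lp_submod_closed.
HB.instance Definition _ := [SubChoice_isSubLmodule of lp p1 by <:].

Lemma lpP (f : lp p1) : lp_summable p f.
Proof. by case: f => f /= /asboolP. Qed.
Arguments lpP : clear implicits.

Lemma lp_valD (f g : lp p1) : lp_val (f + g) = lp_val f + lp_val g.
Proof. by []. Qed.

Lemma lp_valB (f g : lp p1) : lp_val (f - g) = lp_val f - lp_val g.
Proof. by []. Qed.

Lemma lp_valZ (z : R[i]) (f : lp p1) : lp_val (z *: f) = z *: lp_val f.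
Proof. by []. Qed.

Let nrm (f : lp p1) : R[i] := (lp_norm p f)%:C.

Let nrmD f g : nrm (f + g) <= nrm f + nrm g.
Proof. by rewrite -rmorphD lecR lp_valD; exact: (lpD p1 (lpP f) (lpP g)).2. Qed.

Let nrmZ_le (z : R[i]) f : nrm (z *: f) <= `|z| * nrm f.
Proof. by rewrite normcE -rmorphM lecR lp_valZ; exact: (lpZ z p0 (lpP f)).2. Qed.

Let nrmZ (z : R[i]) f : nrm (z *: f) = `|z| * nrm f.
Proof.
apply/eqP; rewrite eq_le nrmZ_le /=.
have [->|z0] := eqVneq z 0.
  by rewrite normr0 mul0r ler0c lp_norm_ge0.
rewrite -ler_pdivlMl ?normr_gt0// -normfV.
by rewrite -{1}(scalerK z0 f) nrmZ_le.
Qed.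

Let nrm0 f : nrm f = 0 -> f = 0.
Proof.
by move=> [] /(lp_norm_eq0 p0 (lpP f)) f0; apply: val_inj; exact: f0.
Qed.

HB.instance Definition _ := Lmodule_isNormed.Build R[i] (lp p1) nrmD nrmZ nrm0.

Lemma lp_normE (f : lp p1) : `|f| = (lp_norm p f)%:C. Proof. by []. Qed.

End lp_instances.
Arguments lpP {R p p1} f.

Section lp_complete.
Variables (R : realType) (p : R) (p1 : 1 <= p).
Let p0 : 0 < p := exponent_gt0 p1.

Lemma lp_ballE (f g : lp p1) (e : R) : ball f e%:C g -> lp_norm p (lp_val f - lp_val g) < e.
Proof. by rewrite -ball_normE /ball_ /= lp_normE ltcR. Qed.

Lemma sum_const_powR n (e : R) : 0 < e ->
  \sum_(0 <= k < n) (e / n.+1%:R) `^ p <= e `^ p.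
Proof.
move=> e0; rewrite sumr_const_nat subn0 -[leLHS]mulr_natl.
have d0 : 0 <= e / n.+1%:R by rewrite divr_ge0// ltW.
have {2}-> : e = n.+1%:R * (e / n.+1%:R) by rewrite mulrC divfK ?pnatr_eq0.
rewrite [leRHS]powRM// ler_wpM2r ?powR_ge0//.
by rewrite (@le_trans _ _ n.+1%:R) ?ler_nat// le1r_powR// ler1n.
Qed.

Lemma lp_cauchy_cvg (F : set_system (lp p1)) : ProperFilter F -> cauchy F -> cvg F.
Proof.
move=> FF Fc.
have Fb (e : R) : 0 < e -> exists x : lp p1, F [set f | lp_norm p (lp_val x - lp_val f) < e].
  move=> e0; have /cauchyP /(_ e%:C) := Fc.
  rewrite ltcR => /(_ e0) [x Fx]; exists x; apply: filterS Fx => f; exact: lp_ballE.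
have coordF (phi : R[i] -> R) k : {morph phi : x y / x - y} ->
    (forall x, `|phi x| <= normc x) -> exists l : R, phi (lp_val f k) @[f --> F] --> l.
  move=> phiB phin.
  suff /cvg_ex [l Fl] : cvg (phi (lp_val f k) @[f --> F]) by exists l.
  apply: R_complete; apply/cauchyP.
  move=> e e0; have [x Fx] := Fb e e0; exists (phi (lp_val x k)).
  rewrite /nbhs /= /fmap /=; apply: filterS Fx => f /= xf.
  rewrite -ball_normE /ball_ /= -phiB (le_lt_trans (phin _))//.
  apply: le_lt_trans xf; rewrite -lp_valB.
  exact: (lp_coord k p0 (lpP (x - f))).
have coord k : exists l : R[i], forall e : R, 0 < e ->
    F [set f | normc (l - lp_val f k) < e].
  have [a Fa] := coordF _ k (@ReB R) (@Re_le_normc R).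
  have [b Fb'] := coordF _ k (@ImB R) (@Im_le_normc R).
  exists (a +i* b) => e e0; have e20 : 0 < e / 2 by rewrite divr_gt0.
  move/cvgrPdist_lt : Fa => /(_ _ e20); move/cvgrPdist_lt : Fb' => /(_ _ e20).
  apply: filterS2 => f /= fb fa.
  rewrite (le_lt_trans (normc_le_ReIm _))// ReB ImB /= [ltRHS]splitr.
  by rewrite ltrD.
have [L LF] := choice coord.
have Lx (e : R) (x : lp p1) : 0 < e ->
    F [set f | lp_norm p (lp_val x - lp_val f) < e] ->
    lp_summable p (L - lp_val x) /\ lp_norm p (L - lp_val x) <= e + e.
  move=> e0 Fx; apply: lp_bound => //; first by rewrite addr_ge0// ltW.
  move=> n.
  have Fn : F [set f | forall k, (k < n)%N -> normc (L k - lp_val f k) < e / n.+1%:R].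
    elim: {1}n => [|m IH]; first by apply: filterE.
    have h := LF m (e / n.+1%:R); have /h : 0 < e / n.+1%:R by rewrite divr_gt0.
    apply: filterS2 IH => f /= fm fmm k; rewrite ltnS leq_eqVlt => /predU1P[->//|].
    exact: fm.
  have [g [/= gn xg]] := filter_ex (filterI Fn Fx).
  have ex : \sum_(0 <= k < n) normc (lp_val g k - lp_val x k) `^ p <= e `^ p.
    apply: (@le_trans _ _ (lp_norm p (lp_val (x - g)) `^ p)).
      apply: le_trans (lp_sum_le n p0 (lpP (x - g))).
      by apply: ler_sum => k _; rewrite -(normcN (lp_val g k - lp_val x k)) opprB.
    by apply: ler_pow; [exact: ltW|exact: lp_norm_ge0|exact: ltW].
  have eL : \sum_(0 <= k < n) normc (L k - lp_val g k) `^ p <= e `^ p.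
    apply: le_trans (sum_const_powR n e0).
    apply: ler_sum_nat => k /andP[_ kn].
    by apply: ler_pow; [exact: ltW|exact: normc_ge0|exact/ltW/gn].
  have := minkowski_sum p1 (fun k => normc_ge0 (L k - lp_val g k))
    (fun k => normc_ge0 (lp_val g k - lp_val x k)) (ltW e0) (ltW e0) eL ex.
  apply: le_trans; apply: ler_sum => k _; apply: ler_pow; [exact: ltW|exact: normc_ge0|].
  by apply: le_trans (ler_normcD _ _); rewrite addrA subrK.
have [x1 Fx1] := Fb 1 ltr01.
have Lsum : lp_summable p L.
  have [sx _] := Lx 1 x1 ltr01 Fx1.
  by rewrite -(subrK (lp_val x1) L); apply: (lpD p1 sx (lpP x1)).1.
have Lin : L \in lp_pred p by apply/asboolP.
apply/cvg_ex; exists (Lp p1 Lin); apply/cvgrPdist_lt => -[e e'].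
rewrite ltcE /= => /andP[/eqP -> e0].
have e40 : 0 < e / 4 by rewrite divr_gt0.
have [x Fx] := Fb _ e40; have [Lx1 Lx2] := Lx _ x e40 Fx.
apply: filterS Fx => f /= xf.
rewrite lp_normE ltcR lp_valB /=.
rewrite -(subrK (lp_val x) L) -addrA.
apply: le_lt_trans (lpD p1 Lx1 (lpP (x - f))).2 _.
have -> : e = (e / 4 + e / 4 + e / 4) + e / 4 by field.
apply: (@lt_trans _ _ (e / 4 + e / 4 + e / 4)); last by rewrite ltrDl.
by rewrite ler_ltD.
Qed.

HB.instance Definition _ := Uniform_isComplete.Build (lp p1) lp_cauchy_cvg.

End lp_complete.

Section pairing.
Variables (R : realType) (p q : R) (p1 : 1 <= p) (q1 : 1 <= q).
Hypothesis pq : p^-1 + q^-1 = 1.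
Implicit Types (f : lp p1) (g : lp q1).
Let p0 : 0 < p := exponent_gt0 p1.
Let q0 : 0 < q := exponent_gt0 q1.

(* The bilinear pairing (no conjugation) under which l^q is the Banach space
   dual of l^p. *)
Definition lp_pairing f g : R[i] := limn (series (fun n => f n * g n)).

Lemma hoelder_lp f g n :
  \sum_(0 <= k < n) normc (f k * g k) <= lp_norm p f * lp_norm q g.
Proof.
under eq_bigr do rewrite normcM.
exact: (hoelder_sum p0 q0 pq (fun k => normc_ge0 (f k)) (fun k => normc_ge0 (g k))
  (lp_norm_ge0 p f) (lp_norm_ge0 q g) (lp_sum_le n p0 (lpP f)) (lp_sum_le n q0 (lpP g))).
Qed.

Lemma cvg_lp_pairing f g : cvgn (series (fun n => f n * g n)).
Proof. exact: cvg_cseriesP (hoelder_lp f g). Qed.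

Lemma normc_lp_pairing f g : normc (lp_pairing f g) <= lp_norm p f * lp_norm q g.
Proof.
apply: normc_lim_le; first exact: cvg_lp_pairing.
by move=> n; apply: le_trans (ler_normc_sum _ _) (hoelder_lp f g n).
Qed.

Lemma lp_pairingDl f f' g : lp_pairing (f + f') g = lp_pairing f g + lp_pairing f' g.
Proof.
rewrite /lp_pairing -limD; [|exact: cvg_lp_pairing|exact: cvg_lp_pairing].
congr (limn _); apply/funext => n.
rewrite -[RHS]/(series (fun n => f n * g n) n + series (fun n => f' n * g n) n).
rewrite /series /= -big_split /=.
by apply: eq_bigr => k _; rewrite -mulrDl.
Qed.

Lemma lp_pairingDr f g g' : lp_pairing f (g + g') = lp_pairing f g + lp_pairing f g'.
Proof.
rewrite /lp_pairing -limD; [|exact: cvg_lp_pairing|exact: cvg_lp_pairing].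
congr (limn _); apply/funext => n.
rewrite -[RHS]/(series (fun n => f n * g n) n + series (fun n => f n * g' n) n).
rewrite /series /= -big_split /=.
by apply: eq_bigr => k _; rewrite -mulrDr.
Qed.

Lemma lp_pairingZl (z : R[i]) f g : lp_pairing (z *: f) g = z * lp_pairing f g.
Proof.
rewrite /lp_pairing -[RHS]/(z *: _) -limZr; last exact: cvg_lp_pairing.
congr (limn _); apply/funext => n.
rewrite -[RHS]/(z * series (fun n => f n * g n) n) /series /= mulr_sumr.
by apply: eq_bigr => k _; rewrite -[X in X * _ = _]/(z * f k) -mulrA.
Qed.

Lemma lp_pairingZr (z : R[i]) f g : lp_pairing f (z *: g) = z * lp_pairing f g.
Proof.
rewrite /lp_pairing -[RHS]/(z *: _) -limZr; last exact: cvg_lp_pairing.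
congr (limn _); apply/funext => n.
rewrite -[RHS]/(z * series (fun n => f n * g n) n) /series /= mulr_sumr.
by apply: eq_bigr => k _; rewrite -[X in _ * X = _]/(z * g k) mulrCA.
Qed.

End pairing.

Lemma sum_nat_cat (V : nmodType) (u : nat -> V) m n : (m <= n)%N ->
  \sum_(0 <= k < n) u k = \sum_(0 <= k < m) u k + \sum_(m <= k < n) u k.
Proof. by move=> mn; rewrite (big_cat_nat _ (n := m)). Qed.

Lemma sum_nat_eq0 (V : nmodType) (u : nat -> V) m n :
  (forall k, (m <= k < n)%N -> u k = 0) -> \sum_(m <= k < n) u k = 0.
Proof. by move=> u0; rewrite big_nat_cond big1// => k /andP[/u0]. Qed.

Section truncation.
Variables (R : realType) (p : R) (p1 : 1 <= p).
Let p0 : 0 < p := exponent_gt0 p1.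

Lemma truncation_summable (u : nat -> R[i]) N :
  let v := fun k => if (k < N)%N then u k else 0 in
  lp_summable p v /\ lp_norm p v <= (\sum_(0 <= k < N) normc (u k) `^ p) `^ p^-1.
Proof.
move=> v; apply: lp_bound => // [|n]; first exact: powR_ge0.
rewrite powRK ?sumr_ge0// => [|k _]; last exact: powR_ge0.
have vN m : \sum_(0 <= k < N + m) normc (v k) `^ p = \sum_(0 <= k < N) normc (u k) `^ p.
  rewrite (sum_nat_cat _ (leq_addr m N)) [X in _ + X]sum_nat_eq0 ?addr0.
    by apply: eq_big_nat => k /andP[_ kN]; rewrite /v kN.
  move=> k /andP[Nk _]; rewrite /v ltnNge Nk /=.
  by rewrite expr0n /= addr0 sqrtr0 powR0// gt_eqF.
rewrite -(vN n) addnC (sum_nat_cat _ (leq_addr N n)) lerDl sumr_ge0// => k _.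
exact: powR_ge0.
Qed.

Lemma truncation_in (u : nat -> R[i]) N :
  (fun k => if (k < N)%N then u k else 0) \in lp_pred p.
Proof. by apply/asboolP; exact: (truncation_summable u N).1. Qed.

Definition truncation (u : nat -> R[i]) N : lp p1 := Lp p1 (truncation_in u N).

Definition unit_vector n : lp p1 := truncation (fun k => (k == n)%:R) n.+1.

Lemma unit_vectorE n k : unit_vector n k = (k == n)%:R.
Proof. by rewrite /= ltnS leq_eqVlt; case: eqVneq => //= _; case: ifP. Qed.

Lemma truncation0 u : truncation u 0 = 0.
Proof. by apply: val_inj; apply/funext => k. Qed.

Lemma truncationS u N : truncation u N.+1 = truncation u N + u N *: unit_vector N.
Proof.
apply: val_inj; apply/funext => k.
rewrite -[RHS]/(truncation u N k + u N * unit_vector N k) unit_vectorE /=.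
rewrite ltnS leq_eqVlt; case: eqVneq => [->|_] /=; first by rewrite ltnn mulr1 add0r.
by rewrite mulr0 addr0.
Qed.

Lemma truncation_cvg (f : lp p1) (e : R) : 0 < e ->
  exists N, forall n, (N <= n)%N -> lp_norm p (lp_val (f - truncation f n)) <= e.
Proof.
move=> e0; have ep0 : 0 < e `^ p by rewrite powR_gt0.
have /cvgrPdist_lt /(_ _ ep0) [N _ NP] := lpP f.
exists N => n Nn; have h := NP n Nn; apply: (lp_bound p0 (ltW e0) _).2 => m.
have nd : nondecreasing_seq (series (fun n => normc (f n) `^ p)).
  by apply: nondecreasing_series => k _ _; exact: powR_ge0.
have zero k : (k < n)%N -> (lp_val (f - truncation f n)) k = 0.
  by move=> kn; rewrite lp_valB -[LHS]/(lp_val f k - truncation f n k) /= kn subrr.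
have same k : (n <= k)%N -> (lp_val (f - truncation f n)) k = f k.
  by move=> nk; rewrite lp_valB -[LHS]/(lp_val f k - truncation f n k) /= ltnNge nk /= subr0.
have p00 : normc (0 : R[i]) `^ p = 0 by rewrite /= expr0n /= addr0 sqrtr0 powR0// gt_eqF.
apply: (@le_trans _ _ (series (fun n => normc (f n) `^ p) (n + m)%N - series (fun n => normc (f n) `^ p) n)).
  rewrite sub_series_geq ?leq_addr//.
  apply: (@le_trans _ _ (\sum_(0 <= k < n + m) normc (lp_val (f - truncation f n) k) `^ p)).
    rewrite addnC (sum_nat_cat _ (leq_addr n m)) lerDl sumr_ge0// => k _.
    exact: powR_ge0.
  rewrite (sum_nat_cat _ (leq_addr m n)) [X in X + _]sum_nat_eq0 ?add0r.
    by apply: ler_sum_nat => k /andP[nk _]; rewrite same.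
  by move=> k /andP[_ kn]; rewrite zero.
apply: le_trans (ltW (le_lt_trans (ler_norm _) h)).
by rewrite lerB// nondecreasing_cvgn_le//; exact: lpP.
Qed.

End truncation.

Section bounded_operators.
Variable R : realType.

Lemma bounded_operator_lp (p q : R) (p1 : 1 <= p) (q1 : 1 <= q)
    (T : bounded_operator (lp p1) (lp q1)) :
  exists2 K : R, 0 <= K & forall f, lp_norm q (T f) <= K * lp_norm p f.
Proof.
have [M TM] := bop_bounded T; exists (normc M); first exact: normc_ge0.
move=> f; suff : `|T f| <= `|M| * `|f|.
  by rewrite lp_normE normcE lp_normE -rmorphM lecR.
apply: (le_trans (TM f)); have h : 0 <= M * `|f| by apply: le_trans (TM f).
by rewrite -(ger0_norm h) normrM normr_id.
Qed.

End bounded_operators.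

Section cesaro.
Variables (R : realType) (p : R) (p1 : 1 < p).
Let p0 : 0 < p := lt_trans ltr01 p1.

Definition cesaro_seq (f : nat -> R[i]) : nat -> R[i] :=
  fun n => n.+1%:R^-1 * \sum_(k < n.+1) f k.

Lemma cesaro_bounded (f : lp (ltW p1)) :
  lp_summable p (cesaro_seq f) /\
  lp_norm p (cesaro_seq f) <= p / (p - 1) * lp_norm p f.
Proof.
pose q := p / (p - 1).
have pB1 : 0 < p - 1 by rewrite subr_gt0.
have q1 : 1 < q by rewrite /q ltr_pdivlMr// mul1r ltrBlDr ltrDl.
have pq : p^-1 + q^-1 = 1 by rewrite /q; field; rewrite !gt_eqF.
have q0 : 0 <= q by rewrite ltW// (lt_trans ltr01).
apply: lp_bound => // [|n]; first by rewrite mulr_ge0// lp_norm_ge0.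
rewrite powRM ?lp_norm_ge0//.
apply: le_trans; last first.
  by apply: ler_wpM2l (lp_sum_le n p0 (lpP f)); exact: powR_ge0.
apply: le_trans (hardy_sum n p1 q1 pq (fun k => normc_ge0 (f k))).
apply: ler_sum => k _; apply: ler_pow; [exact: ltW|exact: normc_ge0|].
rewrite /cesaro_seq normcM mulrC big_mkord.
have -> : normc (k.+1%:R^-1 : R[i]) = k.+1%:R^-1.
  rewrite (_ : k.+1%:R^-1 = (k.+1%:R^-1)%:C); last by rewrite fmorphV rmorph_nat.
  by rewrite normcR ger0_norm.
by rewrite ler_wpM2r// ler_normc_sum.
Qed.

Lemma cesaro_in (f : lp (ltW p1)) : cesaro_seq f \in lp_pred p.
Proof. by apply/asboolP; exact: (cesaro_bounded f).1. Qed.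

Definition cesaro_fun (f : lp (ltW p1)) : lp (ltW p1) := Lp (ltW p1) (cesaro_in f).

Lemma cesaro_linear : linear cesaro_fun.
Proof.
move=> z f g; apply: val_inj; apply/funext => n.
rewrite -[LHS]/(cesaro_seq (fun k => z * f k + g k) n).
rewrite -[RHS]/(z * cesaro_seq f n + cesaro_seq g n) /cesaro_seq.
by rewrite big_split /= -mulr_sumr; ring.
Qed.

HB.instance Definition _ := GRing.isLinear.Build R[i] _ _ _ cesaro_fun cesaro_linear.

Lemma cesaro_fun_bounded : exists M : R[i], forall f, `|cesaro_fun f| <= M * `|f|.
Proof.
exists (p / (p - 1))%:C => f; rewrite !lp_normE -rmorphM lecR.
exact: (cesaro_bounded f).2.
Qed.

Definition cesaro_op : bounded_operator (lp (ltW p1)) (lp (ltW p1)) :=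
  BoundedOperator cesaro_fun_bounded.

Lemma cesaro_opE f n : cesaro_op f n = n.+1%:R^-1 * \sum_(k < n.+1) f k.
Proof. by []. Qed.

End cesaro.

Section adjoint.
Variables (R : realType) (p q : R) (p1 : 1 <= p) (q1 : 1 <= q).
Hypothesis pq : p^-1 + q^-1 = 1.
Let p0 : 0 < p := exponent_gt0 p1.
Let q0 : 0 < q := exponent_gt0 q1.

Lemma lp_pairing_truncation u N (g : lp q1) :
  lp_pairing (truncation p1 u N) g = \sum_(0 <= k < N) u k * g k.
Proof.
apply: cvg_lim => //; apply: cvg_near_cst; exists N => // n /= Nn.
rewrite /series /= -(subnKC Nn) (sum_nat_cat _ (leq_addr (n - N) N)).
rewrite [X in _ + X]sum_nat_eq0 ?addr0.
  by apply: eq_big_nat => k /andP[_ ->].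
by move=> k /andP[Nk _]; rewrite ltnNge Nk /= mul0r.
Qed.

Lemma lp_pairing_unit n (g : lp q1) : lp_pairing (unit_vector p1 n) g = g n.
Proof.
rewrite lp_pairing_truncation big_nat_recr//= sum_nat_eq0 ?add0r ?eqxx ?mul1r//.
by move=> k /andP[_ kn]; rewrite ltn_eqF// mul0r.
Qed.

Definition is_adjoint (T : bounded_operator (lp p1) (lp p1))
    (S : bounded_operator (lp q1) (lp q1)) :=
  forall f g, lp_pairing (T f) g = lp_pairing f (S g).

Variable T : bounded_operator (lp p1) (lp p1).

Let h (g : lp q1) n := lp_pairing (T (unit_vector p1 n)) g.

Let pairing_T_trunc u N g :
  lp_pairing (T (truncation p1 u N)) g = \sum_(0 <= k < N) u k * h g k.
Proof.
elim: N => [|N IH].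
  rewrite big_geq// truncation0 linear0.
  by rewrite -(scale0r (0 : lp p1)) lp_pairingZl// mul0r.
rewrite truncationS linearD linearZ /= lp_pairingDl// lp_pairingZl// IH.
by rewrite [in RHS]big_nat_recr.
Qed.

Let adjoint_bound : exists2 K : R, 0 <= K & forall g,
  lp_summable q (h g) /\ lp_norm q (h g) <= K * lp_norm q g.
Proof.
have [K K0 TK] := bounded_operator_lp T; exists K => // g.
apply: lp_bound => //; first by rewrite mulr_ge0// lp_norm_ge0.
move=> n.
pose c k := (h g k)^* * ((normc (h g k) ^+ 2)^-1 * normc (h g k) `^ q)%:C.
have ch k : c k * h g k = (normc (h g k) `^ q)%:C.
  rewrite /c mulrAC conjM_normc -rmorphM /= mulrA.
  have [h0|h0] := eqVneq (normc (h g k)) 0.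
    by rewrite h0 powR0 ?gt_eqF// !mulr0.
  by rewrite divff ?mul1r// expf_neq0.
have pqE : (q - 1) * p = q.
  have : q + p = p * q by rewrite -[RHS]mulr1 -pq; field; rewrite !gt_eqF.
  by move=> E; rewrite mulrBl mul1r mulrC -E addrK.
have cn k : normc (c k) `^ p = normc (h g k) `^ q.
  rewrite /c normcM normc_conj normcR ger0_norm; last first.
    by rewrite mulr_ge0 ?powR_ge0// invr_ge0 exprn_ge0// normc_ge0.
  have [h0|h0] := eqVneq (normc (h g k)) 0.
    by rewrite h0 mul0r !powR0 ?gt_eqF.
  rewrite -[in RHS]pqE powRrM; congr (_ `^ p).
  rewrite powRB ?h0 ?implybT// powRr1 ?normc_ge0//; field.
  by rewrite h0.
set S := \sum_(0 <= k < n) normc (h g k) `^ q.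
have S0 : 0 <= S by rewrite sumr_ge0// => k _; exact: powR_ge0.
have E : lp_pairing (T (truncation p1 c n)) g = S%:C.
  rewrite pairing_T_trunc rmorph_sum /=; apply: eq_bigr => k _; exact: ch.
have SK : S <= K * S `^ p^-1 * lp_norm q g.
  have SE : S = normc (lp_pairing (T (truncation p1 c n)) g).
    by rewrite E normcR ger0_norm.
  rewrite [leLHS]SE.
  apply: le_trans (normc_lp_pairing pq _ _) _.
  apply: ler_wpM2r; first exact: lp_norm_ge0.
  apply: le_trans (TK _) _; apply: ler_wpM2l => //.
  apply: le_trans (truncation_summable p1 c n).2 _.
  by under eq_bigr do rewrite cn.
have [->|Sn0] := eqVneq S 0; first exact: powR_ge0.
have Sp : 0 < S by rewrite lt_neqAle eq_sym Sn0.
rewrite -[leLHS](powRK q0 S0); apply: ler_pow; [exact: ltW|exact: powR_ge0|].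
have -> : q^-1 = 1 - p^-1 by rewrite -pq addrC addKr.
rewrite powRB ?Sn0 ?implybT// powRr1// ler_pdivrMr ?powR_gt0//.
by rewrite mulrAC.
Qed.

Let adj_in g : h g \in lp_pred q.
Proof. by have [K _ /(_ g) [? _]] := adjoint_bound; apply/asboolP. Qed.

Let adj g : lp q1 := Lp q1 (adj_in g).

Let adj_linear : linear adj.
Proof.
move=> z f g; apply: val_inj; apply/funext => n.
rewrite -[LHS]/(lp_pairing (T (unit_vector p1 n)) (z *: f + g)).
by rewrite lp_pairingDr// lp_pairingZr.
Qed.

Lemma adjoint_exists : exists S, is_adjoint T S.
Proof.
have bS : exists M : R[i], forall f, `|adj f| <= M * `|f|.
  have [K _ hK] := adjoint_bound; exists K%:C => f.
  by rewrite !lp_normE -rmorphM lecR; exact: (hK f).2.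
pose adjL : {linear lp q1 -> lp q1} :=
  HB.pack adj (GRing.isLinear.Build R[i] (lp q1) (lp q1) _ adj adj_linear).
exists (@BoundedOperator _ _ _ adjL bS) => f g.
apply/esym/cvg_lim => //; apply/cvgrPdist_le => -[e e'].
rewrite ltcE /= => /andP[/eqP -> e0].
have [K K0 TK] := bounded_operator_lp T.
pose d := e / (K * lp_norm q g + 1).
have den : 0 < K * lp_norm q g + 1.
  by rewrite (lt_le_trans ltr01)// lerDr mulr_ge0// lp_norm_ge0.
have d0 : 0 < d by rewrite divr_gt0.
have [N hN] := truncation_cvg f d0.
exists N => // n /= Nn; rewrite normcE lecR /series /=.
rewrite -(pairing_T_trunc f n g).
have -> : lp_pairing (T f) g - lp_pairing (T (truncation p1 f n)) g =
          lp_pairing (T (f - truncation p1 f n)) g.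
  have -> : T f = T (f - truncation p1 f n) + T (truncation p1 f n).
    by rewrite -linearD subrK.
  by rewrite lp_pairingDl// addrK.
apply: le_trans (normc_lp_pairing pq _ _) _.
apply: (@le_trans _ _ (K * d * lp_norm q g)).
  apply: ler_wpM2r; first exact: lp_norm_ge0.
  by apply: le_trans (TK _) _; apply: ler_wpM2l => //; exact: hN.
rewrite mulrAC /d mulrA ler_pdivrMr// mulrC ler_wpM2l ?(ltW e0)//.
by rewrite lerDl.
Qed.

(* Uniquely determined by is_adjoint: see adjointP and adjoint_unique. *)
Definition adjoint : bounded_operator (lp q1) (lp q1) := sval (cid adjoint_exists).

Lemma adjointP : is_adjoint T adjoint.
Proof. exact: svalP (cid adjoint_exists). Qed.

Lemma is_adjointE S g n : is_adjoint T S ->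
  S g n = lp_pairing (T (unit_vector p1 n)) g.
Proof. by move=> TS; rewrite TS lp_pairing_unit. Qed.

Lemma adjoint_unique S : is_adjoint T S -> S =1 adjoint.
Proof.
move=> TS g; apply: val_inj; apply/funext => n.
by rewrite [LHS](is_adjointE g n TS) [RHS](is_adjointE g n adjointP).
Qed.

End adjoint.

Section cesaro_adjoint.
Variables (R : realType) (p q : R) (p1 : 1 < p) (q1 : 1 < q).
Hypothesis pq : p^-1 + q^-1 = 1.

Lemma cesaro_adjointE (f : lp (ltW q1)) n :
  adjoint (ltW q1) pq (cesaro_op p1) f n = limn (fun m => \sum_(n <= k < m) f k / k.+1%:R).
Proof.
have A : is_adjoint (cesaro_op p1) (adjoint (ltW q1) pq (cesaro_op p1)) by exact: adjointP.
rewrite (is_adjointE _ _ A) /lp_pairing.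
congr (limn _); apply/funext => m; rewrite /series /=.
have Ce k : cesaro_op p1 (unit_vector (ltW p1) n) k = (n <= k)%:R / k.+1%:R.
  rewrite cesaro_opE mulrC; congr (_ / _).
  under eq_bigr do rewrite unit_vectorE.
  case: leqP => nk.
    rewrite (bigD1 (Ordinal (nk : (n < k.+1)%N)))//= eqxx big1 ?addr0// => i.
    by rewrite -val_eqE /= => /negbTE ->.
  by rewrite big1// => i _; rewrite ltn_eqF// (leq_trans (ltn_ord i)).
have E k : cesaro_op p1 (unit_vector (ltW p1) n) k * f k = if (n <= k)%N then f k / k.+1%:R else 0.
  by rewrite Ce; case: ifP; rewrite ?mul0r// mul1r mulrC.
rewrite (eq_bigr _ (fun k _ => E k)).
have [nm|mn] := leqP n m.
  rewrite (sum_nat_cat _ nm) [X in X + _]sum_nat_eq0 ?add0r.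
    by apply: eq_big_nat => k /andP[->].
  by move=> k /andP[_ kn]; rewrite leqNgt kn.
rewrite [RHS]big_geq ?(ltnW mn)// sum_nat_eq0// => k /andP[_ km].
by rewrite leqNgt (ltn_trans km mn).
Qed.

End cesaro_adjoint.

(* Main.v *)
(* With w = 1 / z, the eigenvector equation for z is the recurrence
   x (n + 1) = (1 - w / (n + 1)) x n, whose solution behaves like n^(- Re w): it lies
   in l^q iff Re w > 1/q, so the point spectrum is the disc |z - q/2| < q/2.
   For density, expand the eigenvector in powers of w - w0.  The moduli of the
   terms of its n-th coordinate add up to at most
   prod_(k <= n) (|1 - w0/k| + |w - w0|/k), again in l^q when
   |w - w0| < Re w0 - 1/q.  Hence a closed subspace containing the eigenvectors
   near w0 contains the Taylor coefficients, and so the eigenvectors of the whole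
   disc of radius Re w0 - 1/q.  Moving the centre to the right one reaches
   w = 1, 2, 3, ..., where the eigenvectors are finitely supported and span all
   finite sequences. *)
From mathcomp Require Import all_boot all_order all_algebra.
From mathcomp Require Import all_classical all_reals all_analysis.
From mathcomp Require Import complex ring lra.
(* Defs comes last so that its normcE shadows that of complex. *)
Require Import Defs.
Set Implicit Arguments. Unset Strict Implicit. Unset Printing Implicit Defensive.
Import Order.TTheory GRing.Theory Num.Theory.
Import numFieldNormedType.Exports.
Local Open Scope classical_set_scope.
Local Open Scope ring_scope.
Local Open Scope complex_scope.

Local Notation normc := ComplexField.Normc.normc.
Local Notation Re := complex.Re.
Local Notation Im := complex.Im.

(** * Closures and subspaces of a normed space, tested with real radii *)

Section closed_subspaces.
Variables (R : realType) (E : normedModType R[i]).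
Implicit Types (A V : set E) (x y : E).

Lemma closure_normP A x : closure A x <->
  forall e : R, 0 < e -> exists2 y, A y & `|x - y| < e%:C.
Proof.
split=> [Ax e e0|Ax B /nbhs_ballP[e' e'0 eB]].
  have e0' : 0 < e%:C by rewrite ltcR.
  have [y [Ay]] := Ax _ (nbhsx_ballx x e%:C e0').
  by rewrite -ball_normE /ball_ /= => xy; exists y.
move: e'0 eB; case: e' => e e'; rewrite /= ltcE /= => /andP[/eqP -> e0] eB.
by have [y Ay xy] := Ax e e0; exists y; split=> //; apply: eB; rewrite -ball_normE.
Qed.

Definition subspace V := V 0 /\ forall (a : R[i]) x y, V x -> V y -> V (a *: x + y).

Lemma subspaceZ V a x : subspace V -> V x -> V (a *: x).
Proof. by move=> [V0 VP] Vx; rewrite -[_ *: _]addr0; exact: VP. Qed.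

Lemma subspaceB V x y : subspace V -> V x -> V y -> V (x - y).
Proof. by move=> [V0 VP] Vx Vy; rewrite addrC -scaleN1r; exact: VP. Qed.

Lemma subspaceD V x y : subspace V -> V x -> V y -> V (x + y).
Proof. by move=> [V0 VP] Vx Vy; rewrite -[x]scale1r; exact: VP. Qed.

Lemma subspace_sum V (I : Type) (s : seq I) (F : I -> E) : subspace V ->
  (forall i, V (F i)) -> V (\sum_(i <- s) F i).
Proof.
move=> sV VF; elim: s => [|i s IH]; first by rewrite big_nil; exact: sV.1.
by rewrite big_cons; exact: subspaceD.
Qed.

Lemma subspace_closure V : subspace V -> subspace (closure V).
Proof.
move=> sV; split; first by apply: subset_closure; exact: sV.1.
move=> a x y /closure_normP Vx /closure_normP Vy; apply/closure_normP => e e0.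
have d0 : 0 < normc a + 1 by rewrite ltr_wpDl// normc_ge0.
have e20 : 0 < e / 2 by rewrite divr_gt0.
have [x' Vx' xx'] := Vx (e / 2 / (normc a + 1)) (divr_gt0 e20 d0).
have [y' Vy' yy'] := Vy _ e20.
exists (a *: x' + y'); first exact: sV.2.
have -> : a *: x + y - (a *: x' + y') = a *: (x - x') + (y - y').
  by rewrite scalerBr opprD !addrA; congr (_ + _); rewrite addrAC.
rewrite (le_lt_trans (ler_normD _ _))// normrZ.
have -> : e%:C = (e / 2)%:C + (e / 2)%:C by rewrite -rmorphD -splitr.
apply: ler_ltD => //.
apply: (@le_trans _ _ ((normc a)%:C * (e / 2 / (normc a + 1))%:C)).
  by apply: ler_wpM2l; [exact: normr_ge0|exact: ltW].
rewrite -rmorphM lecR mulrA ler_pdivrMr// mulrC ler_wpM2l ?(ltW e20)//.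
by rewrite lerDl.
Qed.

End closed_subspaces.

(** * Linear spans and totality *)

Section spans.
Variables (R : realType) (E : completeNormedModType R[i]) (A : set E).

Lemma subspace_linear_span : subspace (linear_span A).
Proof.
split; first by exists 0%N, (fun=> 0), (fun=> 0); rewrite big_ord0; split=> [[]|].
move=> a _ _ [n [c [v [Av ->]]]] [m [d [u [Au ->]]]].
exists (n + m)%N, (fun i => match fintype.split i with inl j => a * c j | inr j => d j end).
exists (fun i => match fintype.split i with inl j => v j | inr j => u j end).
split=> [i|]; first by case: (fintype.split i).
rewrite big_split_ord scaler_sumr; congr (_ + _); apply: eq_bigr => i _.
  by rewrite (unsplitK (inl i)) scalerA.
by rewrite (unsplitK (inr i)).
Qed.

Lemma sub_linear_span : A `<=` linear_span A.
Proof.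
move=> x Ax; exists 1%N, (fun=> 1), (fun=> x); split=> //.
by rewrite big_ord1 scale1r.
Qed.

Lemma total_setP : (forall x, closure (linear_span A) x) -> total_set A.
Proof.
move=> cA O [x Ox] oO; have [y [Ay Oy]] := cA x O (open_nbhs_nbhs (conj oO Ox)).
by exists y.
Qed.

End spans.

(** * Power series with values in a closed subspace *)

Section power_series.
Variables (R : realType) (E : normedModType R[i]) (V : set E).
Hypotheses (sV : subspace V) (cV : closed V).
Variables (phi : R[i] -> E) (a : nat -> E) (M r : R).
Hypothesis r0 : 0 < r.
(** A remainder estimate for every partial sum stands for a convergent power series, so that no
    infinite sum in [E] is formed. *)
Hypothesis phi_expansion : forall h k, normc h <= r ->
  `|phi h - \sum_(j < k) h ^+ j *: a j| <= ((normc h / r) ^+ k * M)%:C.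

Lemma expansion_bound_ge0 : 0 <= M.
Proof.
have := @phi_expansion 0 0%N; rewrite normcR normr0 => /(_ (ltW r0)).
by rewrite expr0 mul1r => /(le_trans (normr_ge0 _)); rewrite ler0c.
Qed.

(* The j-th coefficient is the limit of (phi h - \sum_(i < j) h ^+ i *: a i) / h ^+ j
   as h tends to 0. *)
Lemma coefficient_in_closed_subspace (e : R) : 0 < e ->
  (forall h, normc h < e -> V (phi h)) -> forall j, V (a j).
Proof.
move=> e0 Vphi; elim/ltn_ind => j IH; apply: cV; apply/closure_normP => d d0.
have M0 := expansion_bound_ge0.
have N0 : 0 < M / r ^+ j.+1 + 1 by rewrite ltr_wpDl// divr_ge0// exprn_ge0// ltW.
(* The three bounds serve in turn: [phi t] lies in [V], the expansion applies at [t], and the error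
   [t * (M / r ^+ j.+1)] falls below [d]. *)
pose t := Num.min (Num.min (e / 2) r) (d / 2 / (M / r ^+ j.+1 + 1)).
have t0 : 0 < t by rewrite !lt_min r0 !divr_gt0.
have te : t < e.
  rewrite (@le_lt_trans _ _ (e / 2))//; first by rewrite !ge_min lexx.
  by rewrite ltr_pdivrMr// ltr_pMr// ltr1n.
have tr : t <= r by rewrite !ge_min lexx orbT.
have td : t * (M / r ^+ j.+1) < d.
  apply: (@le_lt_trans _ _ (d / 2)); last first.
    by rewrite ltr_pdivrMr// ltr_pMr// ltr1n.
  have : t <= d / 2 / (M / r ^+ j.+1 + 1) by rewrite !ge_min lexx !orbT.
  rewrite ler_pdivlMr//; apply: le_trans.
  by rewrite ler_wpM2l ?(ltW t0)// lerDl.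
have nt : normc t%:C = t by rewrite normcR ger0_norm// ltW.
have tC0 : t%:C ^+ j != 0 by rewrite expf_neq0// fmorph_eq0 gt_eqF.
exists ((t%:C ^+ j)^-1 *: (phi t%:C - \sum_(i < j) t%:C ^+ i *: a i)).
  apply: subspaceZ => //; apply: subspaceB => //; first by apply: Vphi; rewrite nt.
  by apply: subspace_sum => // i; apply: subspaceZ => //; exact: IH.
rewrite distrC.
have -> : (t%:C ^+ j)^-1 *: (phi t%:C - \sum_(i < j) t%:C ^+ i *: a i) - a j
  = (t%:C ^+ j)^-1 *: (phi t%:C - \sum_(i < j.+1) t%:C ^+ i *: a i).
  by rewrite big_ord_recr /= opprD addrA [RHS]scalerBr scalerA mulVf// scale1r.
rewrite normrZ.
have := @phi_expansion t%:C j.+1; rewrite nt => /(_ tr) h.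
have -> : `|(t%:C ^+ j)^-1| = ((t ^+ j)^-1)%:C.
  by rewrite normfV normrX (normcE t%:C) nt fmorphV rmorphXn.
apply: le_lt_trans (ler_wpM2l _ h) _.
  by rewrite ler0c invr_ge0 exprn_ge0// ltW.
rewrite -rmorphM ltcR; apply: le_lt_trans td.
rewrite expr_div_n le_eqVlt; apply/orP; left; apply/eqP.
by rewrite [t ^+ j.+1]exprS; field; rewrite !gt_eqF// exprn_gt0.
Qed.

(** The coefficients lie in [V], hence so do the partial sums, which converge geometrically to
    [phi h] on the whole disc of radius [r], however small [e] is. *)
Lemma power_series_in_closed_subspace (e : R) : 0 < e ->
  (forall h, normc h < e -> V (phi h)) -> forall h, normc h < r -> V (phi h).
Proof.
move=> e0 Vphi h hr; have Va := coefficient_in_closed_subspace e0 Vphi.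
apply: cV; apply/closure_normP => d d0.
have M0 := expansion_bound_ge0.
have s1 : `|normc h / r| < 1.
  by rewrite ger0_norm ?divr_ge0 ?normc_ge0 ?(ltW r0)// ltr_pdivrMr// mul1r.
have M10 : 0 < M + 1 by rewrite ltr_wpDl.
have /cvgrPdist_lt /(_ _ (divr_gt0 d0 M10)) [k _ /(_ k (leqnn k))] := cvg_expr s1.
rewrite /= sub0r normrN ger0_norm; last first.
  by rewrite exprn_ge0// divr_ge0 ?normc_ge0// ltW.
rewrite ltr_pdivlMr// => hk.
exists (\sum_(j < k) h ^+ j *: a j).
  by apply: subspace_sum => // j; apply: subspaceZ => //; exact: Va.
apply: le_lt_trans (@phi_expansion h k (ltW hr)) _.
rewrite ltcR; apply: le_lt_trans hk; rewrite ler_wpM2l ?lerDl//.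
by rewrite exprn_ge0// divr_ge0 ?normc_ge0// ltW.
Qed.

End power_series.

(** * Taylor remainders of polynomials *)

Section polynomial_remainder.
Variables (R : realType) (P : {poly R[i]}) (r B : R).
Hypothesis r0 : 0 < r.
Hypothesis coef_bound : forall J, \sum_(j < J) normc P`_j * r ^+ j <= B.

(** Since [s = |h| / r <= 1], a term of degree at least [k] is at most [s ^+ k] times its bound at
    radius [r]. The degree of [P] does not enter. *)
Lemma polynomial_taylor_remainder h k : normc h <= r ->
  normc (P.[h] - \sum_(j < k) h ^+ j * P`_j) <= (normc h / r) ^+ k * B.
Proof.
move=> hr; set s := normc h / r.
have s0 : 0 <= s by rewrite divr_ge0 ?normc_ge0// ltW.
have s1 : s <= 1 by rewrite ler_pdivrMr// mul1r.
(* Padding up to [k + size P] allows the split at [k] even when [k] exceeds the degree. *)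
rewrite (@horner_coef_wide _ (k + size P)) ?leq_addl// big_split_ord /=.
under [X in X + _ - _]eq_bigr do rewrite mulrC.
rewrite addrAC subrr add0r (le_trans (ler_normc_sum _ _))//.
apply: le_trans (ler_wpM2l (exprn_ge0 k s0) (coef_bound (k + size P))).
rewrite big_split_ord /= mulrDr ler_wpDl//.
  rewrite mulr_ge0 ?exprn_ge0// sumr_ge0// => j _.
  by rewrite mulr_ge0 ?normc_ge0// exprn_ge0// ltW.
rewrite mulr_sumr; apply: ler_sum => j _.
have nX n : normc (h ^+ n) = s ^+ n * r ^+ n.
  rewrite -exprMn /s divfK ?gt_eqF//; elim: n => [|n IH].
    by rewrite expr0 (_ : 1 = 1%:C)// normcR normr1.
  by rewrite !exprS normcM IH.
rewrite normcM nX mulrCA mulrA [leRHS]mulrA ler_wpM2r//; first by rewrite exprn_ge0// ltW.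
rewrite ler_wpM2r ?normc_ge0// exprD ler_piMr ?exprn_ge0//.
by rewrite exprn_ile1.
Qed.

End polynomial_remainder.

(** * The eigenvector sequence, its Taylor polynomials and its majorant *)

Section cesaro_eigenvectors.
Variable R : realType.
Implicit Types (w h : R[i]) (r : R) (n k : nat).

Definition cesaro_factor w k : R[i] := 1 - w / k.+1%:R.

(* The solution of x n / (n + 1) = z * (x n - x (n + 1)) with x 0 = 1, in the
   parameter w = 1 / z. *)
Definition cesaro_ev w n : R[i] := \prod_(k < n) cesaro_factor w k.

(** [cesaro_ev] near [w] as a polynomial in the increment. *)
Definition cesaro_ev_poly w n : {poly R[i]} :=
  \prod_(k < n) ((cesaro_factor w k)%:P - k.+1%:R^-1 *: 'X).

(* Bounds the sum of the moduli of the terms of the Taylor expansion of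
   cesaro_ev at w, on the disc of radius r. *)
Definition cesaro_majorant w r n : R :=
  \prod_(k < n) (normc (cesaro_factor w k) + r / k.+1%:R).

Lemma cesaro_evS w n : cesaro_ev w n.+1 = cesaro_ev w n * cesaro_factor w n.
Proof. by rewrite /cesaro_ev big_ord_recr. Qed.

Lemma horner_cesaro_ev_poly w h n : (cesaro_ev_poly w n).[h] = cesaro_ev (w + h) n.
Proof.
rewrite horner_prod; apply: eq_bigr => k _.
by rewrite !hornerE /cesaro_factor mulrDl opprD addrA [_^-1 * h]mulrC.
Qed.

Lemma cesaro_majorant0 w n : cesaro_majorant w 0 n = normc (cesaro_ev w n).
Proof.
elim: n => [|n IH].
  by rewrite /cesaro_majorant /cesaro_ev !big_ord0 (_ : 1 = 1%:C)// normcR normr1.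
by rewrite cesaro_evS normcM -IH /cesaro_majorant big_ord_recr /= mul0r addr0.
Qed.

Lemma cesaro_majorant_ge0 w r n : 0 <= r -> 0 <= cesaro_majorant w r n.
Proof.
by move=> r0; apply: prodr_ge0 => k _; rewrite addr_ge0 ?normc_ge0// divr_ge0.
Qed.

Lemma normc_natV k : normc (k.+1%:R^-1 : R[i]) = k.+1%:R^-1.
Proof.
rewrite (_ : k.+1%:R^-1 = (k.+1%:R^-1)%:C); last by rewrite fmorphV rmorph_nat.
by rewrite normcR ger0_norm.
Qed.

(** The sum of the moduli of the coefficients, weighted by powers of [r], is submultiplicative, and
    the majorant is the product of the weighted sums of the linear factors. *)
Lemma cesaro_coef_bound w r n J : 0 <= r ->
  \sum_(j < J) normc (cesaro_ev_poly w n)`_j * r ^+ j <= cesaro_majorant w r n.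
Proof.
move=> r0; elim: n J => [|n IH] J.
  rewrite /cesaro_ev_poly /cesaro_majorant !big_ord0.
  case: J => [|J]; first by rewrite big_ord0.
  rewrite big_ord_recl big1 => [|j _]; rewrite coef1.
    by rewrite eqxx (_ : true%:R = 1%:C)// normcR normr1 mul1r addr0.
  by rewrite (_ : (_ == _)%:R = 0%:C)// normcR normr0 mul0r.
case: J => [|J]; first by rewrite big_ord0 cesaro_majorant_ge0.
have E j : (cesaro_ev_poly w n.+1)`_j = cesaro_factor w n * (cesaro_ev_poly w n)`_j
    - n.+1%:R^-1 * (if j is j'.+1 then (cesaro_ev_poly w n)`_j' else 0).
  rewrite {1}/cesaro_ev_poly big_ord_recr /= -/(cesaro_ev_poly w n).
  rewrite mulrBr coefB coefMC -scalerAr coefZ coefMX [_ * cesaro_factor _ _]mulrC.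
  by case: j.
have -> : cesaro_majorant w r n.+1 = normc (cesaro_factor w n) * cesaro_majorant w r n
    + r / n.+1%:R * cesaro_majorant w r n.
  by rewrite /cesaro_majorant big_ord_recr /= mulrDr [X in X + _]mulrC [X in _ + X]mulrC.
apply: le_trans (lerD (ler_wpM2l (normc_ge0 _) (IH J.+1))
  (ler_wpM2l (divr_ge0 r0 (ler0n _ n.+1)) (IH J))).
rewrite !mulr_sumr [X in _ <= X + _]big_ord_recl big_ord_recl -addrA.
apply: lerD; first by rewrite E /= mulr0 subr0 normcM mulrA.
rewrite -big_split /=; apply: ler_sum => j _; rewrite E /=.
apply: (@le_trans _ _ ((normc (cesaro_factor w n * (cesaro_ev_poly w n)`_(lift ord0 j))
    + normc (n.+1%:R^-1 * (cesaro_ev_poly w n)`_j)) * r ^+ (lift ord0 j))).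
  by rewrite ler_wpM2r ?exprn_ge0// -(normcN (n.+1%:R^-1 * _)) ler_normcD.
rewrite !normcM normc_natV mulrDl !mulrA lerD2l /= /bump /= add1n exprS.
rewrite le_eqVlt; apply/orP; left; apply/eqP; ring.
Qed.

End cesaro_eigenvectors.

(** * Raabe's convergence test *)

Section raabe.
Variable R : realType.
Implicit Types (x : nat -> R) (y : R).

(* Raabe's test: the hypothesis gives
   (y - 1) * x (k + 1) <= (k + 1) * x k - (k + 2) * x (k + 1). *)
Lemma raabe_bounded x y K : 1 < y -> (forall k, 0 <= x k) ->
  (forall k, (K <= k)%N -> (k.+1%:R + y) * x k.+1 <= k.+1%:R * x k) ->
  exists2 B, 0 <= B & forall N, \sum_(0 <= n < N) x n <= B.
Proof.
move=> y1 x0 xS; have y10 : 0 < y - 1 by rewrite subr_gt0.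
have T m : (y - 1) * \sum_(0 <= k < m) x (K + k).+1 + (K + m).+1%:R * x (K + m)%N
    <= K.+1%:R * x K.
  elim: m => [|m IH]; first by rewrite big_geq// mulr0 add0r addn0.
  rewrite big_nat_recr//= addnS mulrDr; apply: le_trans IH.
  rewrite -addrA lerD2l; have := xS (K + m)%N (leq_addr _ _).
  rewrite -[(K + m).+2%:R]natr1; lra.
exists (\sum_(0 <= n < K.+1) x n + K.+1%:R * x K / (y - 1)).
  by rewrite addr_ge0 ?sumr_ge0// divr_ge0 ?mulr_ge0// ltW.
move=> N; apply: (@le_trans _ _ (\sum_(0 <= n < K.+1 + N) x n)).
  by rewrite addnC (sum_nat_cat _ (leq_addr K.+1 N)) lerDl sumr_ge0.
rewrite (sum_nat_cat _ (leq_addr N K.+1)) lerD2l ler_pdivlMr// mulrC.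
apply: le_trans (T N).
have -> : \sum_(K.+1 <= k < K.+1 + N) x k = \sum_(0 <= k < N) x (K + k).+1.
  rewrite -{1}[K.+1]add0n big_addn addKn.
  by apply: eq_bigr => k _; rewrite addnS addnC.
by rewrite lerDl mulr_ge0.
Qed.

End raabe.

(** * Summability exactly on the half-plane [Re w > 1/q] *)

Section cesaro_ev_summability.
Variables (R : realType) (q : R).
Hypothesis q1 : 1 < q.
Let q0 : 0 < q := lt_trans ltr01 q1.
Implicit Types (w : R[i]) (r s : R) (n k : nat).

Lemma cesaro_factorE (a b : R) k :
  cesaro_factor (a +i* b) k = (1 - a / k.+1%:R) +i* (- (b / k.+1%:R)).
Proof.
rewrite /cesaro_factor (_ : k.+1%:R^-1 = (k.+1%:R^-1)%:C); last first.
  by rewrite fmorphV rmorph_nat.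
by simpc.
Qed.

(** With [m = k + 1], [|1 - w/m|^2 = 1 - 2 Re w/m + |w|^2/m^2 <= 1 - 2s/m <= (1 - s/m)^2]. *)
Lemma normc_cesaro_factor_le w s k : s <= k.+1%:R ->
  normc w ^+ 2 <= 2 * (Re w - s) * k.+1%:R ->
  normc (cesaro_factor w k) <= 1 - s / k.+1%:R.
Proof.
case: w => a b sk; rewrite cesaro_factorE /= sqr_sqrtr ?addr_ge0 ?sqr_ge0// => h.
have t0 : 0 < k.+1%:R^-1 :> R by rewrite invr_gt0.
have st : 0 <= 1 - s / k.+1%:R by rewrite subr_ge0 ler_pdivrMr// mul1r.
rewrite -[leRHS]ger0_norm// -sqrtr_sqr ler_wsqrtr//.
move: h; rewrite -ler_pdivrMr//; move: t0; set t := k.+1%:R^-1 => t0 h.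
have := ler_wpM2r (ltW t0) h; have := mulr_ge0 (sqr_ge0 s) (sqr_ge0 t).
lra.
Qed.

Lemma normc_cesaro_factor_ge w s k : s <= 1 -> Re w <= s ->
  1 - s / k.+1%:R <= normc (cesaro_factor w k).
Proof.
case: w => a b s1 /= as_; apply: le_trans (Re_le_normc _).
rewrite cesaro_factorE /= (le_trans _ (ler_norm _))// lerD2l lerN2.
by rewrite ler_wpM2r// invr_ge0.
Qed.

(** With [m = k + 1], a late factor is at most [1 - (s - r)/m], and its power [q] at most
    [exp(-y/m) <= 1/(1 + y/m)] for [y = q * (s - r) > 1]: Raabe's test applies. *)
Lemma cesaro_majorant_summable w r : 0 <= r -> q^-1 < Re w - r ->
  exists2 M, 0 <= M &
    forall N, \sum_(0 <= n < N) cesaro_majorant w r n `^ q <= M `^ q.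
Proof.
(* The midpoint of [r + 1/q] and [Re w]: [s < Re w] controls the factors, and [s - r > 1/q] makes
   [y > 1]. *)
move=> r0 rw; pose s := (Re w + r + q^-1) / 2.
have sw : 0 < 2 * (Re w - s) by rewrite /s; lra.
have y1 : 1 < q * (s - r).
  by rewrite mulrC -ltr_pdivrMr// div1r /s; lra.
pose K := maxn (Num.bound s) (Num.bound (normc w ^+ 2 / (2 * (Re w - s)))).
have s0 : 0 <= s.
  have : 0 < q^-1 by rewrite invr_gt0.
  by rewrite /s; lra.
have FK k : (K <= k)%N ->
    (k.+1%:R + q * (s - r)) * (normc (cesaro_factor w k) + r / k.+1%:R) `^ q
    <= k.+1%:R.
  rewrite geq_max => /andP[k1 k2].
  have F : normc (cesaro_factor w k) + r / k.+1%:R <= 1 - (s - r) / k.+1%:R.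
    rewrite mulrBl opprB addrA addrAC lerD2r normc_cesaro_factor_le//.
      rewrite (le_trans (ltW (archi_boundP s0)))// ler_nat.
      by rewrite (leq_trans k1).
    rewrite mulrC -ler_pdivrMr//.
    rewrite (le_trans (ltW (archi_boundP _)))// ?ler_nat ?(leq_trans k2)//.
    by rewrite divr_ge0 ?sqr_ge0// ltW.
  have Fexp : (normc (cesaro_factor w k) + r / k.+1%:R) `^ q
      <= (expR (q * (s - r) / k.+1%:R))^-1.
    rewrite -expRN -[q * _ / _]mulrA -mulrN [X in expR X]mulrC expRM.
    apply: ler_pow; [exact: ltW| |exact: le_trans F (expR_ge1Dx _)].
    by rewrite addr_ge0 ?normc_ge0// divr_ge0.
  rewrite -[X in _ <= X]mulr1 -ler_pdivrMl// mulrA.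
  rewrite mulrDr mulVf ?pnatr_eq0// [_^-1 * _]mulrC.
  have e0 := expR_gt0 (q * (s - r) / k.+1%:R).
  have y0 : 0 <= q * (s - r) / k.+1%:R by rewrite divr_ge0// ltW// (lt_trans ltr01).
  apply: (@le_trans _ _ (expR (q * (s - r) / k.+1%:R) * (expR (q * (s - r) / k.+1%:R))^-1)).
    by rewrite ler_pM ?powR_ge0 ?expR_ge1Dx// addr_ge0.
  by rewrite divff// gt_eqF.
have [|k kK|B B0 HB] := @raabe_bounded R (fun n => cesaro_majorant w r n `^ q) _ K y1.
- by move=> k; exact: powR_ge0.
- have -> : cesaro_majorant w r k.+1 = cesaro_majorant w r k *
      (normc (cesaro_factor w k) + r / k.+1%:R).
    by rewrite /cesaro_majorant big_ord_recr.
  rewrite powRM ?cesaro_majorant_ge0// ?addr_ge0 ?normc_ge0 ?divr_ge0//.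
  by rewrite mulrCA [leRHS]mulrC ler_wpM2l ?powR_ge0// FK.
by exists (B `^ q^-1) => [|N]; rewrite ?powR_ge0// powRK.
Qed.

Lemma lp_dominated (f : nat -> R[i]) (G : nat -> R) (C M : R) :
  0 <= C -> 0 <= M -> (forall n, 0 <= G n) ->
  (forall n, normc (f n) <= C * G n) ->
  (forall N, \sum_(0 <= n < N) G n `^ q <= M `^ q) ->
  lp_summable q f /\ lp_norm q f <= C * M.
Proof.
move=> C0 M0 G0 fG GM; apply: lp_bound => //; first exact: mulr_ge0.
move=> N; rewrite powRM//.
apply: le_trans (ler_wpM2l (powR_ge0 _ _) (GM N)).
rewrite mulr_sumr; apply: ler_sum => n _.
by rewrite -powRM// ler_pow ?normc_ge0// ltW.
Qed.

Lemma cesaro_ev_summable w : q^-1 < Re w -> lp_summable q (cesaro_ev w).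
Proof.
rewrite -[X in _ < X]subr0 => /(cesaro_majorant_summable (lexx 0))[M M0 HM].
apply: (@lp_dominated _ (cesaro_majorant w 0) 1 M _ M0 _ _ HM).1 => // n.
  exact: cesaro_majorant_ge0.
by rewrite mul1r cesaro_majorant0.
Qed.

(* Young's inequality gives 1 - 1 / (q m) >= (1 - 1 / m) `^ (1 / q), so |x n| `^ q is
   at least a multiple of the harmonic sequence. *)
Lemma cesaro_ev_lower_bound w n : Re w <= q^-1 ->
  (1 - q^-1) * n.+1%:R^-1 `^ q^-1 <= normc (cesaro_ev w n.+1).
Proof.
move=> wq; have qV1 : q^-1 <= 1 by rewrite invf_le1// ltW.
have qV0 : 0 < q^-1 by rewrite invr_gt0.
elim: n => [|n IH].
  rewrite invr1 powR1 mulr1 cesaro_evS {1}/cesaro_ev big_ord0 mul1r.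
  by apply: le_trans (normc_cesaro_factor_ge 0 qV1 wq); rewrite divr1.
rewrite cesaro_evS normcM.
have -> : n.+2%:R^-1 = n.+1%:R^-1 * (n.+1%:R / n.+2%:R) :> R.
  by rewrite mulrA mulVf ?pnatr_eq0// mul1r.
rewrite powRM ?divr_ge0// mulrA ler_pM//.
  by rewrite mulr_ge0 ?powR_ge0// subr_ge0.
apply: le_trans (normc_cesaro_factor_ge n.+1 qV1 wq).
have p0 : 0 < 1 - q^-1 by rewrite subr_gt0 invf_lt1.
(* With second factor 1, the right-hand side of Young's inequality is exactly
   [1 - q^-1 / n.+2%:R]. *)
have := @conjugate_powR R ((n.+1%:R / n.+2%:R) `^ q^-1) 1 q (1 - q^-1)^-1.
rewrite powR_ge0 q0 invr_gt0 p0 invrK powRK ?divr_ge0// powR1 mul1r mulr1.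
move=> /(_ isT ler01 isT isT); rewrite addrC subrK => /(_ erefl) h.
apply: le_trans h _; rewrite le_eqVlt; apply/orP; left; apply/eqP.
have m0 : 0 < n.+1%:R + 1 :> R by rewrite ltr_wpDr.
move: m0; rewrite -[n.+2%:R]natr1; move: (n.+1%:R) => m m0.
by field; rewrite !gt_eqF.
Qed.

(** Otherwise [cesaro_ev_lower_bound], raised to the power [q], would make the harmonic series
    converge. *)
Lemma cesaro_ev_summable_Re w : lp_summable q (cesaro_ev w) -> q^-1 < Re w.
Proof.
move=> sw; rewrite ltNge; apply/negP => wq.
have qV1 : q^-1 <= 1 by rewrite invf_le1// ltW.
have c0 : 0 < (1 - q^-1) `^ q by rewrite powR_gt0// subr_gt0 invf_lt1.
apply: (@dvg_harmonic R); apply: nondecreasing_is_cvgn.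
  by apply: nondecreasing_series => n _ _; rewrite /harmonic /= invr_ge0.
exists (lp_norm q (cesaro_ev w) `^ q / (1 - q^-1) `^ q) => _ [N _ <-].
rewrite ler_pdivlMr//; apply: le_trans (lp_sum_le N.+1 q0 sw).
rewrite [leRHS]big_nat_recl// ler_wpDl ?powR_ge0// /series /= mulr_suml.
apply: ler_sum => n _; rewrite /harmonic /= mulrC.
rewrite -[X in _ * X](powRK q0) ?invr_ge0// -powRM ?powR_ge0 ?subr_ge0//.
apply: ler_pow; [exact: ltW| |exact: cesaro_ev_lower_bound].
by rewrite mulr_ge0 ?powR_ge0// subr_ge0.
Qed.

End cesaro_ev_summability.

(** * Kernels and point spectrum of the adjoint *)

Section cesaro_adjoint_kernel.
Variables (R : realType) (p q : R) (p1 : 1 < p) (q1 : 1 < q).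
Hypothesis pq : p^-1 + q^-1 = 1.
Let T := adjoint (ltW q1) pq (cesaro_op p1).
Implicit Types (x : lp (ltW q1)) (w z : R[i]).

(** The terms of a convergent series tend to 0. This removes the constant left free when the
    eigenvector equation is known only for consecutive differences. *)
Lemma lp_cst_eq0 x : (forall n, x n = x n.+1) -> x = 0.
Proof.
move=> xS; have xE n : x n = x 0%N by elim: n => // n <-; rewrite -xS.
have q0 : 0 < q := lt_trans ltr01 q1.
have := cvg_series_cvg_0 (lpP x); under eq_fun do rewrite xE.
move=> /(cvg_lim (@Rhausdorff R)); rewrite lim_cst; last exact: Rhausdorff.
move=> x0; apply: val_inj; apply/funext => n /=; rewrite xE.
by apply: normc_eq0; apply: powR_eq0_eq0 x0.
Qed.

(** The images under [cesaro_op] of the unit vectors [n] and [n + 1] differ only in coordinate [n],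
    by [1/(n + 1)]; pair with [x]. *)
Lemma cesaro_adjointB x n : T x n - T x n.+1 = x n / n.+1%:R.
Proof.
have A : is_adjoint (cesaro_op p1) T by exact: adjointP.
rewrite !(is_adjointE _ _ A).
have -> : cesaro_op p1 (unit_vector (ltW p1) n) =
    n.+1%:R^-1 *: unit_vector (ltW p1) n + cesaro_op p1 (unit_vector (ltW p1) n.+1).
  apply: val_inj; apply/funext => k.
  rewrite -[RHS]/(n.+1%:R^-1 * unit_vector (ltW p1) n k
    + cesaro_op p1 (unit_vector (ltW p1) n.+1) k).
  rewrite [LHS]cesaro_opE cesaro_opE unit_vectorE.
  have E m : \sum_(j < k.+1) unit_vector (ltW p1) m j = (m <= k)%:R.
    under eq_bigr do rewrite unit_vectorE.
    case: leqP => mk.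
      rewrite (bigD1 (Ordinal (mk : (m < k.+1)%N)))//= eqxx big1 ?addr0// => i.
      by rewrite -val_eqE /= => /negbTE ->.
    by rewrite big1// => i _; rewrite ltn_eqF// (leq_trans (ltn_ord i)).
  rewrite !E leq_eqVlt eq_sym; case: eqVneq => [->|_] /=.
    by rewrite ltnn mulr0 addr0.
  by rewrite mulr0 add0r.
rewrite lp_pairingDl// lp_pairingZl// lp_pairing_unit addrK mulrC.
by [].
Qed.

Lemma cesaro_adjoint_kernelP z x :
  kernel T z x <-> forall n, x n / n.+1%:R = z * (x n - x n.+1).
Proof.
split=> [/eqP|xS].
  rewrite subr_eq0 => /eqP Tx n.
  by rewrite -cesaro_adjointB Tx !lp_valZ mulrBr.
apply: lp_cst_eq0 => n; apply/eqP; rewrite -subr_eq0; apply/eqP.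
rewrite lp_valB lp_valZ.
rewrite -[LHS]/(T x n - z * x n - (T x n.+1 - z * x n.+1)).
have := cesaro_adjointB x n; rewrite xS => E.
by rewrite -[RHS](subrr (z * (x n - x n.+1))) -{1}E; ring.
Qed.

Lemma cesaro_adjoint_kernel0 x : kernel T 0 x -> x = 0.
Proof.
move=> /cesaro_adjoint_kernelP xS; apply: val_inj; apply/funext => n.
have := xS n; rewrite mul0r => /eqP.
by rewrite mulf_eq0 invr_eq0 pnatr_eq0 orbF => /eqP.
Qed.

Lemma cesaro_adjoint_eigenvectorE z x n : kernel T z x -> z != 0 ->
  x n = x 0%N * cesaro_ev z^-1 n.
Proof.
move=> /cesaro_adjoint_kernelP xS z0; elim: n => [|n IH].
  by rewrite /cesaro_ev big_ord0 mulr1.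
rewrite cesaro_evS mulrA -IH /cesaro_factor.
apply: (mulfI z0); rewrite -[x n.+1](subKr (x n)) mulrBr -xS.
by field; rewrite z0 -[_ + _]/(1 + n%:R) addrC natr1 pnatr_eq0.
Qed.

(** The default 0 is taken when [Re w <= 1/q], where the sequence is not in l^q. *)
Definition cesaro_eigenvector w : lp (ltW q1) := insubd 0 (cesaro_ev w).

Lemma cesaro_eigenvector_val w : q^-1 < Re w ->
  lp_val (cesaro_eigenvector w) = cesaro_ev w.
Proof. by move=> wq; apply: insubdK; apply/asboolP; exact: cesaro_ev_summable. Qed.

Lemma cesaro_eigenvector_neq0 w : q^-1 < Re w -> cesaro_eigenvector w != 0.
Proof.
move=> wq; apply/eqP => /(congr1 (fun x => lp_val x 0%N)).
rewrite cesaro_eigenvector_val// /cesaro_ev big_ord0 => /eqP.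
by rewrite -[lp_val _ _]/0 oner_eq0.
Qed.

Lemma kernel_cesaro_eigenvector w : q^-1 < Re w ->
  kernel T w^-1 (cesaro_eigenvector w).
Proof.
move=> wq; apply/cesaro_adjoint_kernelP => n.
have w0 : w != 0.
  apply: contraTneq wq => ->; rewrite -leNgt invr_ge0 ltW//.
  exact: lt_trans ltr01 q1.
rewrite cesaro_eigenvector_val// cesaro_evS /cesaro_factor.
by field; rewrite w0 -[_ + _]/(1 + n%:R) addrC natr1 pnatr_eq0.
Qed.

(** An eigenvector is a nonzero multiple of [cesaro_ev z^-1], so this sequence must lie in l^q. *)
Lemma cesaro_adjoint_point_spectrumP z :
  point_spectrum T z <-> z != 0 /\ q^-1 < Re z^-1.
Proof.
split=> [[x x0 Tx]|[z0 zq]]; last first.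
  exists (cesaro_eigenvector z^-1); first exact: cesaro_eigenvector_neq0.
  by rewrite -{1}[z]invrK; exact: kernel_cesaro_eigenvector.
have z0 : z != 0.
  by apply: contraNneq x0 => z0; apply/eqP; apply: cesaro_adjoint_kernel0; rewrite -z0.
split=> //; apply: (cesaro_ev_summable_Re q1).
have xE n := cesaro_adjoint_eigenvectorE n Tx z0.
have x00 : x 0%N != 0.
  apply: contraNneq x0 => x00; apply/eqP/val_inj/funext => n.
  by rewrite /= xE x00 mul0r.
have -> : cesaro_ev z^-1 = (x 0%N)^-1 *: lp_val x.
  apply/funext => n; rewrite -[RHS]/((x 0%N)^-1 * x n) (xE n) mulrA mulVf ?mul1r//.
exact: (lpZ _ (lt_trans ltr01 q1) (lpP x)).1.
Qed.

End cesaro_adjoint_kernel.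

(** * Continuation of the eigenvectors through the half-plane *)

Section eigenvector_continuation.
Variables (R : realType) (q : R) (q1 : 1 < q).
Let q0 : 0 < q := lt_trans ltr01 q1.
Implicit Types (w h : R[i]).
Local Notation ev := (cesaro_eigenvector q1).

Lemma Re_addr_ge w h : Re w - normc h <= Re (w + h).
Proof.
rewrite ReD lerD2l lerNl (le_trans _ (Re_le_normc h))// -normrN.
exact: ler_norm.
Qed.

(** In each coordinate the polynomial remainder is at most the majorant times a factor independent
    of the coordinate, and the majorant is in l^q. *)
Lemma cesaro_eigenvector_expansion w (r : R) : 0 < r -> q^-1 < Re w - r ->
  exists (a : nat -> lp (ltW q1)) (M : R), forall h k, normc h <= r ->
    `|ev (w + h) - \sum_(j < k) h ^+ j *: a j| <= ((normc h / r) ^+ k * M)%:C.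
Proof.
move=> r0 wr; have [M M0 HM] := cesaro_majorant_summable q1 (ltW r0) wr.
have maj0 n := cesaro_majorant_ge0 w n (ltW r0).
pose c j n := (cesaro_ev_poly w n)`_j.
have cB n J := cesaro_coef_bound w n J (ltW r0).
have cS j : lp_summable q (c j).
  apply: (@lp_dominated _ _ q1 _ (cesaro_majorant w r) (r ^+ j)^-1 M _ M0 maj0 _ HM).1.
    by rewrite invr_ge0 exprn_ge0// ltW.
  move=> n; rewrite mulrC ler_pdivlMr ?exprn_gt0//.
  apply: le_trans (cB n j.+1); rewrite big_ord_recr /= lerDr sumr_ge0// => i _.
  by rewrite mulr_ge0 ?normc_ge0// exprn_ge0// ltW.
pose a j : lp (ltW q1) := insubd 0 (c j).
have aE j : lp_val (a j) = c j by apply: insubdK; apply/asboolP.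
exists a, M => h k hr; rewrite lp_normE lecR.
apply: (@lp_dominated _ _ q1 _ (cesaro_majorant w r) _ M _ M0 maj0 _ HM).2.
  by rewrite exprn_ge0// divr_ge0 ?normc_ge0// ltW.
move=> n; have wh : q^-1 < Re (w + h).
  by apply: lt_le_trans (Re_addr_ge w h); rewrite (lt_le_trans wr)// lerD2l lerN2.
have sE : (\sum_(j < k) h ^+ j *: a j : lp (ltW q1)) n = \sum_(j < k) h ^+ j * c j n.
  elim: k => [|k IH]; first by rewrite !big_ord0.
  by rewrite !big_ord_recr /= -IH -aE.
rewrite lp_valB -[X in normc X]/(ev (w + h) n - (\sum_(j < k) h ^+ j *: a j : lp (ltW q1)) n).
rewrite sE cesaro_eigenvector_val// -horner_cesaro_ev_poly.
exact: polynomial_taylor_remainder.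
Qed.

Variable V : set (lp (ltW q1)).
Hypotheses (sV : subspace V) (cV : closed V).

(** A whole disc is required, since recovering Taylor coefficients needs more than membership at
    [w]. *)
Definition near_in w := exists2 e : R, 0 < e & forall h, normc h < e -> V (ev (w + h)).

Lemma near_in_disc w w' : near_in w -> normc (w' - w) < Re w - q^-1 -> near_in w'.
Proof.
move=> [e e0 eV] ww'; pose d := Re w - q^-1 - normc (w' - w).
have d0 : 0 < d by rewrite subr_gt0.
exists (d / 2) => [|h hd]; first by rewrite divr_gt0.
(* Equal to [|w' - w| + d/2]: large enough to reach the disc around [w'], yet below [Re w - 1/q]. *)
pose r := Re w - q^-1 - d / 2.
have r0 : 0 < r by have := normc_ge0 (w' - w); move: d0; rewrite /r /d; lra.
have wr : q^-1 < Re w - r by move: d0; rewrite /r; lra.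
have [a [M aM]] := cesaro_eigenvector_expansion r0 wr.
have -> : w' + h = w + (w' - w + h) by rewrite addrA addrC [w + _]addrC subrK addrC.
apply: (power_series_in_closed_subspace sV cV r0 aM e0 eV).
by apply: le_lt_trans (ler_normcD _ _) _; move: hd; rewrite /r /d; lra.
Qed.

Lemma near_in_mem w : near_in w -> V (ev w).
Proof.
by move=> [e e0 /(_ 0)]; rewrite addr0 normcR normr0; apply.
Qed.

(* The discs of centre w and radius Re w - 1/q, translated to the right, exhaust
   the half-plane. *)
Lemma near_in_natural w m : q^-1 < Re w -> near_in w -> near_in m.+1%:R.
Proof.
(* Half the first radius: all translated discs have radius at least [2 * d], so a step of length [d]
   stays inside. *)
move=> wq Vw; pose d := (Re w - q^-1) / 2.
have d0 : 0 < d by rewrite divr_gt0// subr_gt0.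
have Vn n : near_in (w + (n%:R * d)%:C).
  elim: n => [|n IH]; first by rewrite mul0r addr0.
  apply: near_in_disc IH _.
  have -> : w + (n.+1%:R * d)%:C - (w + (n%:R * d)%:C) = d%:C.
    rewrite -natr1; case: (w) => a b; apply/eqP; rewrite eq_complex /=.
    by apply/andP; split; apply/eqP; ring.
  rewrite normcR gtr0_norm// ReD /= addrAC.
  rewrite (@lt_le_trans _ _ (d + d))//; first by rewrite ltrDl.
  by rewrite /d -splitr lerDl mulr_ge0// ltW.
have qV0 : 0 < q^-1 by rewrite invr_gt0.
have mq : 0 < m.+1%:R - q^-1.
  by rewrite subr_gt0 (@lt_le_trans _ _ 1)// ?invf_lt1// ler1n.
(* In [|m + 1 - w - t|^2 < (Re w + t - 1/q)^2] the squares of [Re w + t] cancel, and [Re w + t > X]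
   suffices. *)
pose X := (m.+1%:R ^+ 2 + Im w ^+ 2) / (2 * (m.+1%:R - q^-1)).
have X0 : 0 <= X by rewrite divr_ge0 ?addr_ge0 ?sqr_ge0// mulr_ge0// ltW.
pose n := Num.bound (X / d).
have nX : X < n%:R * d.
  by rewrite -ltr_pdivrMr// archi_boundP// divr_ge0// ltW.
apply: near_in_disc (Vn n) _.
move: nX; set t := n%:R * d => nX.
have tX : m.+1%:R ^+ 2 + Im w ^+ 2 < 2 * (m.+1%:R - q^-1) * (Re w + t).
  rewrite -ltr_pdivrMl ?mulr_gt0// mulrC -/X (lt_trans nX)// ltrDr.
  exact: lt_trans wq.
rewrite (_ : m.+1%:R = m.+1%:R%:C); last by rewrite rmorph_nat.
move: (m.+1%:R) mq tX => s mq tX.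
have t0 : 0 <= t by rewrite ltW// (le_lt_trans X0).
have dq : 0 < Re w + t - q^-1 by move: wq; lra.
rewrite -[ltRHS]gtr0_norm ?ReD// -sqrtr_sqr.
case: (w) tX dq => a b /= tX dq; rewrite ltr_sqrt ?exprn_gt0//.
have := sqr_ge0 q^-1; lra.
Qed.

Lemma truncation_in_subspace (u : nat -> R[i]) N :
  (forall n, (n < N)%N -> V (unit_vector (ltW q1) n)) -> V (truncation (ltW q1) u N).
Proof.
elim: N => [|N IH] VN; first by rewrite truncation0; exact: sV.1.
rewrite truncationS; apply: subspaceD => //; first by apply: IH => n /ltnW; exact: VN.
by apply: subspaceZ => //; exact: VN.
Qed.

Lemma cesaro_ev_natural n k : (n < k)%N -> cesaro_ev (n.+1%:R : R[i]) k = 0.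
Proof.
move=> nk; rewrite /cesaro_ev (bigD1 (Ordinal nk))//= /cesaro_factor.
by rewrite divff ?pnatr_eq0// subrr mul0r.
Qed.

Lemma cesaro_ev_natural_neq0 n : cesaro_ev (n.+1%:R : R[i]) n != 0.
Proof.
apply/prodf_neq0 => k _; rewrite /cesaro_factor subr_eq0 eq_sym.
apply: contraTneq (ltn_ord k) => /divr1_eq /eqP.
by rewrite eqr_nat eqSS => /eqP nk; rewrite -leqNgt; exact: eq_leq.
Qed.

(** The system is triangular: [ev n.+1%:R] is supported on the indices up to [n], with nonzero
    coordinate [n]. *)
Lemma unit_vector_in_subspace n :
  (forall m, V (ev m.+1%:R)) -> V (unit_vector (ltW q1) n).
Proof.
move=> Vev; elim/ltn_ind: n => n IH.
pose u := cesaro_ev (n.+1%:R : R[i]).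
have uE : ev n.+1%:R = truncation (ltW q1) u n.+1.
  apply: val_inj; apply/funext => k; rewrite /= cesaro_eigenvector_val; last first.
    rewrite -[n.+1%:R](rmorph_nat (real_complex R)) /=.
    by rewrite (@lt_le_trans _ _ 1)// ?invf_lt1// ler1n.
  by case: ltnP => // nk; rewrite cesaro_ev_natural.
have -> : unit_vector (ltW q1) n = (u n)^-1 *: (ev n.+1%:R - truncation (ltW q1) u n).
  rewrite uE truncationS addrAC subrr add0r scalerA mulVf ?scale1r//.
  exact: cesaro_ev_natural_neq0.
apply: subspaceZ => //; apply: subspaceB => //.
exact: truncation_in_subspace.
Qed.

Lemma eigenvectors_near_total w : q^-1 < Re w -> near_in w -> forall x, V x.
Proof.
move=> wq Vw x.
have Vev m : V (ev m.+1%:R) by apply: near_in_mem; exact: near_in_natural Vw.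
apply: cV; apply/closure_normP => e e0.
have [N /(_ N (leqnn N)) xN] := truncation_cvg x (divr_gt0 e0 (ltr0Sn R 1)).
exists (truncation (ltW q1) x N).
  by apply: truncation_in_subspace => n _; exact: unit_vector_in_subspace.
rewrite lp_normE ltcR (le_lt_trans xN)//.
by rewrite ltr_pdivrMr// ltr_pMr// ltr1n.
Qed.

End eigenvector_continuation.

(** * Return from the parameter [w] to the eigenvalue, and conclusion *)

Lemma inv_near_inv (K : numFieldType) (c r : K) : c != 0 -> 0 < r ->
  exists2 e : K, 0 < e & forall h, `|h| < e -> `|c - (c^-1 + h)^-1| < r.
Proof.
move=> c0 r0; have cV0 : c^-1 != 0 by rewrite invr_eq0.
have /cvgrPdist_lt /(_ r r0) /nbhs_ballP[e e0 eB] := inv_continuous cV0.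
exists e => // h he; rewrite -{1}[c]invrK; apply: eB.
by rewrite -ball_normE /ball_ /= opprD addNKr normrN.
Qed.

Theorem theorem5p2 (R : realType) (p q : R) (hp : 1 < p) (hq : 1 < q)
    (hpq : p^-1 + q^-1 = 1) :
  rich_point_spectrum (adjoint (ltW hq) hpq (cesaro_op hp)).
Proof.
have q0 : 0 < q := lt_trans ltr01 hq.
set T := adjoint _ _ _; split=> [|c r r0 cr].
  (* Re z^-1 > 1/q is the disc |z - q/2| < q/2. *)
  have q20 : 0 < q / 2 by rewrite divr_gt0.
  exists (q / 2)%:C; apply/nbhs_ballP; exists (q / 2)%:C; first by rewrite /= ltcR.
  move=> [a b]; rewrite -ball_normE /ball_ /= normcE ltcR /= -[ltRHS]gtr0_norm//.
  rewrite -sqrtr_sqr ltr_sqrt ?exprn_gt0// => ab.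
  have abq : a ^+ 2 + b ^+ 2 < q * a by lra.
  have n0 : 0 < a ^+ 2 + b ^+ 2.
    rewrite lt_neqAle addr_ge0 ?sqr_ge0// andbT eq_sym paddr_eq0 ?sqr_ge0//.
    apply: contraTN abq => /andP[]; rewrite !sqrf_eq0 => /eqP -> /eqP ->.
    by rewrite expr0n /= mulr0 addr0 ltxx.
  apply/cesaro_adjoint_point_spectrumP; split.
    by apply: contraTneq n0 => -[-> ->]; rewrite expr0n /= addr0 ltxx.
  by rewrite /= ltr_pdivlMr// ltr_pdivrMl.
have [c0 cq] := (cesaro_adjoint_point_spectrumP hp hq hpq c).1 (cr _ (ballxx c r0)).
apply: total_setP; set A := \bigcup_(z in _) _.
apply: (@eigenvectors_near_total _ _ hq (closure (linear_span A)) _ _ c^-1) => //.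
- exact/subspace_closure/subspace_linear_span.
- exact: closed_closure.
have [[e e'] + eB] := inv_near_inv c0 r0; rewrite ltcE /= => /andP[/eqP e'0 e0].
(* The first bound keeps the eigenvalue in the given disc, the second keeps [c^-1 + h] in the
   half-plane. *)
exists (Num.min e (Re c^-1 - q^-1)) => [|h]; first by rewrite lt_min e0 subr_gt0.
rewrite lt_min => /andP[he hq'].
apply/subset_closure/sub_linear_span; exists (c^-1 + h)^-1.
  by rewrite -ball_normE /ball_ /=; apply: eB; rewrite e'0 normcE ltcR.
apply: kernel_cesaro_eigenvector; apply: lt_le_trans (Re_addr_ge _ _).
by rewrite ltrBrDr -ltrBrDl.
Qed.
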